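(* There exists a generic polynomial over $\mathbb{Q}$ for the group $\mathrm{SL}_2(\mathbb{F}_3)$.
   Context: Let $G$ be a finite group. A generic polynomial (over $\mathbb{Q}$) for $G$ is an element $P\in\mathbb{Q}(t_1,\ldots,t_s)[X]$, where $t_1,\dots,t_s$ are indeterminates, such that: (i) the Galois group of $P$ over $\mathbb{Q}(t_1,\ldots,t_s)$ is $G$; and (ii) for every field $K$ containing $\mathbb{Q}$ and every Galois extension $L/K$ whose Galois group is (isomorphic to) a subgroup of $G$, there exist values $\tau_1,\dots,\tau_s\in K$ such that the specialization $t_i\mapsto \tau_i$ is defined on the coefficients of $P$ and the splitting field over $K$ of the specialized polynomial is equal to $L$. *)

(* Defs.v *)
From HB Require Import structures.
From mathcomp Require Import all_boot all_order all_algebra all_fingroup all_solvable all_field.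
From mathcomp Require Import fraction.
From mathcomp Require Import mpoly.
Set Implicit Arguments. Unset Strict Implicit. Unset Printing Implicit Defensive.
Import GRing.Theory.
Local Open Scope ring_scope.

Definition ratfun (s : nat) : fieldType := {fraction {mpoly rat[s]}}.

Definition mev (s : nat) (K : fieldType) (tau : 'I_s -> K) (p : {mpoly rat[s]}) : K :=
  mmap (fun q : rat => ratr q) tau p.

Definition spec_coef (s : nat) (K : fieldType) (tau : 'I_s -> K)
  (c : ratfun s) (k : K) : Prop :=
  exists n d : {mpoly rat[s]},
    [/\ mev tau d != 0, c = FracField.tofrac n / FracField.tofrac d & k = mev tau n / mev tau d].

Definition spec_poly (s : nat) (K : fieldType) (tau : 'I_s -> K)
  (P : {poly ratfun s}) (Q : {poly K}) : Prop :=
  forall i : nat, spec_coef tau P`_i Q`_i.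

Definition SL2F3 : {set {'GL_2['F_3]}} :=
  [set g : {'GL_2['F_3]} | \det (GLval g) == 1].

Definition generic_poly (gT : finGroupType) (G : {set gT}) (s : nat)
  (P : {poly ratfun s}) : Prop :=
  (exists E : splittingFieldType (ratfun s),
      splittingFieldFor 1%VS (map_poly (in_alg E) P) fullv /\
      ('Gal((fullv : {vspace E}) / 1%VS) \isog G)%g)
  /\
  (forall (K : fieldType), [pchar K] =i pred0 ->
   forall (L : splittingFieldType K), galois 1%VS (fullv : {vspace L}) ->
   (exists H : {group gT}, (H \subset G)%g /\ ('Gal((fullv : {vspace L}) / 1%VS) \isog H)%g) ->
   exists (tau : 'I_s -> K) (Q : {poly K}),
     spec_poly tau P Q /\ splittingFieldFor 1%VS (map_poly (in_alg L) Q) fullv).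

(* Main.v *)
Require Import Defs.
From HB Require Import structures.
From mathcomp Require Import all_boot all_order all_algebra all_fingroup all_solvable all_field.
From mathcomp Require Import generic_quotient fraction.
From mathcomp Require Import mpoly.
From mathcomp Require Import ring.

(** SL_2(F_3) permutes the eight nonzero vectors v of F_3^2; let x_v, with
    x_(-v) = - x_v, be four indeterminates, on which it acts by signed
    permutations, and let M = Q(x_v).  Reading x as the quaternion
    x0 + x1 i + x2 j + x3 k, the normal subgroup Q_8 acts by left
    multiplication and the quotient C_3 permutes i, j, k.  Let r_mn be the
    entries of the corresponding 3 x 3 rotation matrix scaled by the norm N:
    Q_8 only changes signs of rows of (r_mn), so it fixes b1 = r12 / r11,
    b2 = r23 / r22, b3 = r31 / r33, and C_3 permutes b1, b2, b3 cyclically.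
    The orthogonality relations express the remaining ratios in the b_i, so
    that M is obtained from k(r), with k = Q(theta) generated by N and three
    C_3-invariants of the b_i and r = (b1 - b2) / (b2 - b3) a root of a cyclic
    cubic, by three successive square roots r11, r22 and x0.  Hence the fixed
    field of SL_2(F_3) in M is k; and theta is algebraically independent by the
    Jacobian criterion, the derivations being the infinitesimal right
    multiplications by i, j, k and the Euler field.  The minimal polynomial P
    over k of a linear form z in the x_v with trivial stabiliser then has group
    SL_2(F_3).

    Given L / K with a group embedded in SL_2(F_3), the equivariant points x of
    L^4 form a K-vector space that spans L^4, so some of them avoid any given
    hypersurface; for a suitable one, tau = theta(x) is Galois invariant and P
    specialises at tau to the product of the X - (g z)(x), whose roots generate
    L. *)

Set Implicit Arguments. Unset Strict Implicit. Unset Printing Implicit Defensive.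
Import GRing.Theory.
Local Open Scope ring_scope.

(** * Rational coefficients in characteristic zero *)

Section CharZero.
Variables (K : fieldType) (charK : [pchar K] =i pred0).

Lemma pchar0_intr_eq0 (a : int) : ((a%:~R : K) == 0) = (a == 0).
Proof.
have nat0 := (@pcharf0P K).1 charK.
case: a => n; first by rewrite nat0.
by rewrite NegzE mulrNz oppr_eq0 nat0.
Qed.

Lemma pchar0_ratr_frac (a b : int) : b != 0 ->
  ratr (a%:~R / b%:~R : rat) = a%:~R / b%:~R :> K.
Proof.
move=> b0; set q := a%:~R / b%:~R.
have db : (denq q)%:~R != 0 :> K by rewrite pchar0_intr_eq0 denq_neq0.
have bK : b%:~R != 0 :> K by rewrite pchar0_intr_eq0.
apply/eqP; rewrite /ratr eqr_div // -!intrM; apply/eqP; congr (_%:~R).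
have b1 : b%:~R != 0 :> rat by rewrite intr_eq0.
have d1 : (denq q)%:~R != 0 :> rat by rewrite intr_eq0 denq_neq0.
have /eqP := divq_num_den q; rewrite /q eqr_div // -!intrM => /eqP /intr_inj.
by rewrite -/q.
Qed.

Lemma pchar0_ratr_zmod_morphism : zmod_morphism (ratr : rat -> K).
Proof.
move=> x y; rewrite -[x in LHS]divq_num_den -[y in LHS]divq_num_den.
set a := numq x; set b := denq x; set c := numq y; set d := denq y.
have [b0 d0] : b != 0 /\ d != 0 by rewrite !denq_neq0.
have [bq dq] : b%:~R != 0 :> rat /\ d%:~R != 0 :> rat by rewrite !intr_eq0.
have [bK dK] : b%:~R != 0 :> K /\ d%:~R != 0 :> K by rewrite !pchar0_intr_eq0.
have -> : a%:~R / b%:~R - c%:~R / d%:~R = (a * d - c * b)%:~R / (b * d)%:~R :> rat.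
  by rewrite intrB !intrM; field; rewrite bq dq.
rewrite pchar0_ratr_frac ?mulf_neq0 // /ratr -/a -/b -/c -/d intrB !intrM.
by field; rewrite bK dK.
Qed.

Lemma pchar0_ratr_monoid_morphism : monoid_morphism (ratr : rat -> K).
Proof.
split=> [|x y]; first by rewrite /ratr divr1.
rewrite -[x in LHS]divq_num_den -[y in LHS]divq_num_den.
set a := numq x; set b := denq x; set c := numq y; set d := denq y.
have [b0 d0] : b != 0 /\ d != 0 by rewrite !denq_neq0.
have [bK dK] : b%:~R != 0 :> K /\ d%:~R != 0 :> K by rewrite !pchar0_intr_eq0.
rewrite mulf_div -!intrM pchar0_ratr_frac ?mulf_neq0 // /ratr -/a -/b -/c -/d.
by rewrite mulf_div -!intrM.
Qed.

(* [ratr] is a canonical ring morphism only into number fields; the phantom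
   argument makes it one into any field of characteristic 0. *)
Definition ratr0 (_ : [pchar K] =i pred0) (q : rat) : K := ratr q.

HB.instance Definition _ := GRing.isZmodMorphism.Build rat K (ratr0 charK)
  pchar0_ratr_zmod_morphism.
HB.instance Definition _ := GRing.isMonoidMorphism.Build rat K (ratr0 charK)
  pchar0_ratr_monoid_morphism.

Definition mev0 (_ : [pchar K] =i pred0) (s : nat) (tau : 'I_s -> K)
  (p : {mpoly rat[s]}) : K := mev tau p.

Lemma mev0_zmod_morphism s (tau : 'I_s -> K) : zmod_morphism (mev0 charK tau).
Proof. exact: (raddfB (mmap (ratr0 charK) tau)). Qed.
Lemma mev0_monoid_morphism s (tau : 'I_s -> K) : monoid_morphism (mev0 charK tau).
Proof.
by split; [exact: (rmorph1 (mmap (ratr0 charK) tau))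
          |exact: (rmorphM (mmap (ratr0 charK) tau))].
Qed.
HB.instance Definition _ s (tau : 'I_s -> K) :=
  GRing.isZmodMorphism.Build {mpoly rat[s]} K (mev0 charK tau)
    (mev0_zmod_morphism tau).
HB.instance Definition _ s (tau : 'I_s -> K) :=
  GRing.isMonoidMorphism.Build {mpoly rat[s]} K (mev0 charK tau)
    (mev0_monoid_morphism tau).

Section Mev.
Variables (s : nat) (tau : 'I_s -> K).
Implicit Types p q : {mpoly rat[s]}.

Lemma mevD p q : mev tau (p + q) = mev tau p + mev tau q.
Proof. exact: (rmorphD (mev0 charK tau)). Qed.
Lemma mevN p : mev tau (- p) = - mev tau p.
Proof. exact: (rmorphN (mev0 charK tau)). Qed.
Lemma mevM p q : mev tau (p * q) = mev tau p * mev tau q.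
Proof. exact: (rmorphM (mev0 charK tau)). Qed.
Lemma mev1 : mev tau 1 = 1.
Proof. exact: (rmorph1 (mev0 charK tau)). Qed.
Lemma mev_0 : mev tau 0 = 0.
Proof. exact: (rmorph0 (mev0 charK tau)). Qed.
Lemma mevC c : mev tau c%:MP = ratr c.
Proof. exact: (mmapC tau (ratr0 charK)). Qed.
Lemma mevX i : mev tau 'X_i = tau i.
Proof. by rewrite /mev (mmapX tau (ratr0 charK)) mmap1U. Qed.
End Mev.

End CharZero.

Lemma eq_mev (s : nat) (K : fieldType) (t1 t2 : 'I_s -> K) : t1 =1 t2 ->
  mev t1 =1 mev t2.
Proof.
by move=> e p; apply: eq_bigr => m _; congr (_ * _); apply: mmap1_eq.
Qed.

(** Identities between evaluations respect sums and products, so they only have to be tested on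
    constants and indeterminates. *)
Lemma mpoly_rmorph_ind (s : nat) (P : {mpoly rat[s]} -> Prop) :
  (forall c, P c%:MP) -> (forall i, P 'X_i) ->
  (forall p q, P p -> P q -> P (p + q)) -> (forall p q, P p -> P q -> P (p * q)) ->
  forall p, P p.
Proof.
move=> PC PX PD PM p; elim/mpolyind: p => [|c m p _ _ Pp]; first exact: PC 0.
apply: PD => //; rewrite -mul_mpolyC; apply: (PM) => //.
rewrite mpolyXE_id; apply: (big_rec P) => [|i x _ Px]; first exact: PC 1.
apply: (PM) => //; elim: (m i) => [|k IH]; first exact: PC 1.
by rewrite exprS; apply: (PM).
Qed.

Lemma fmorph_mev (s : nat) (K L : fieldType) (f : {rmorphism K -> L})
  (tau : 'I_s -> K) p : f (mev tau p) = mev (f \o tau) p.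
Proof.
rewrite /mev rmorph_sum; apply: eq_bigr => m _.
rewrite rmorphM /=.
congr (_ * _); first by rewrite /ratr fmorph_div !rmorph_int.
by rewrite rmorph_prod; apply: eq_bigr => i _; rewrite rmorphXn.
Qed.

(** * Fraction fields *)

Section FractionField.
Variable R : idomainType.
Local Notation "x %:F" := (@FracField.tofrac R x).

Lemma frac_numden (x : {fraction R}) : x = (\n_(repr x))%:F / (\d_(repr x))%:F.
Proof.
have d0 : \d_(repr x) != 0 :> R by apply: denom_ratioP.
rewrite -{1}[x]reprK; move: (repr x) d0 => {x} r d0.
apply: (canRL (mulfK _)); first by rewrite tofrac_eq0.
rewrite !piE; apply/eqmodP; rewrite /= FracField.equivfE /FracField.mulf.
by rewrite !numden_Ratio ?mulf_neq0 ?oner_neq0 // !mulr1 mulrC.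
Qed.

Lemma fracP (x : {fraction R}) : exists n d, d != 0 /\ x = n%:F / d%:F.
Proof.
exists \n_(repr x), \d_(repr x); split; first exact: denom_ratioP.
exact: frac_numden.
Qed.

Lemma frac_eq (n d n' d' : R) : d != 0 -> d' != 0 ->
  n%:F / d%:F = n'%:F / d'%:F -> n * d' = n' * d.
Proof.
move=> d0 d'0 /eqP; rewrite eqr_div ?tofrac_eq0 // -!tofracM tofrac_eq.
by move/eqP.
Qed.

Section Lift.
Variables (M : fieldType) (f : {rmorphism R -> M}) (f_inj : injective f).

(** Injectivity, which keeps denominators nonzero, is an argument so that the morphism structure can
    be attached to [frac_lift f_inj]. *)
Definition frac_lift (_ : injective f) (x : {fraction R}) : M :=
  f \n_(repr x) / f \d_(repr x).

Let f_neq0 d : d != 0 -> f d != 0.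
Proof. by move=> d0; rewrite -(rmorph0 f) (inj_eq f_inj). Qed.

Lemma frac_lift_div n d : d != 0 -> frac_lift f_inj (n%:F / d%:F) = f n / f d.
Proof.
move=> d0; rewrite /frac_lift; set x := n%:F / d%:F.
have d'0 : \d_(repr x) != 0 :> R by apply: denom_ratioP.
have /(frac_eq d0 d'0) e : n%:F / d%:F = (\n_(repr x))%:F / (\d_(repr x))%:F.
  by rewrite -frac_numden.
by apply/eqP; rewrite eqr_div ?f_neq0 // -!rmorphM e.
Qed.

Lemma frac_lift_tofrac n : frac_lift f_inj n%:F = f n.
Proof.
by rewrite -[n%:F]divr1 -tofrac1 frac_lift_div ?oner_neq0 // rmorph1 divr1.
Qed.

Lemma frac_lift_zmod_morphism : zmod_morphism (frac_lift f_inj).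
Proof.
move=> x y; have [a [b [b0 ->]]] := fracP x; have [c [d [d0 ->]]] := fracP y.
have -> : a%:F / b%:F - c%:F / d%:F = (a * d - c * b)%:F / (b * d)%:F.
  rewrite -mulNr addf_div ?tofrac_eq0 //.
  by rewrite tofracM tofracB !tofracM mulNr.
rewrite !frac_lift_div ?mulf_neq0 // -[in RHS]mulNr addf_div ?f_neq0 //.
by rewrite rmorphM rmorphB !rmorphM mulNr.
Qed.

Lemma frac_lift_monoid_morphism : monoid_morphism (frac_lift f_inj).
Proof.
split=> [|x y]; first by rewrite -tofrac1 frac_lift_tofrac rmorph1.
have [a [b [b0 ->]]] := fracP x; have [c [d [d0 ->]]] := fracP y.
rewrite mulf_div -!tofracM !frac_lift_div ?mulf_neq0 //.
by rewrite mulf_div !rmorphM.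
Qed.

HB.instance Definition _ := GRing.isZmodMorphism.Build {fraction R} M
  (frac_lift f_inj) frac_lift_zmod_morphism.
HB.instance Definition _ := GRing.isMonoidMorphism.Build {fraction R} M
  (frac_lift f_inj) frac_lift_monoid_morphism.
End Lift.

Section Derivation.
Variables (D : R -> R).
Hypothesis (DB : zmod_morphism D) (DM : forall x y, D (x * y) = D x * y + x * D y).

Definition frac_der (x : {fraction R}) : {fraction R} :=
  (D \n_(repr x) * \d_(repr x) - \n_(repr x) * D \d_(repr x))%:F
    / (\d_(repr x) ^+ 2)%:F.

Let D1 : D 1 = 0.
Proof.
by apply: (addrI (D 1)); rewrite addr0 -[RHS](congr1 D (mulr1 1)) DM mulr1 mul1r.
Qed.

(** The quotient rule does not depend on the fraction chosen: two fractions for one element satisfy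
    n d' = n' d, and this relation can be differentiated. *)
Lemma frac_der_div n d : d != 0 ->
  frac_der (n%:F / d%:F) = (D n * d - n * D d)%:F / (d ^+ 2)%:F.
Proof.
move=> d0; rewrite /frac_der; set x := n%:F / d%:F.
have d'0 : \d_(repr x) != 0 :> R by apply: denom_ratioP.
have /(frac_eq d0 d'0) : n%:F / d%:F = (\n_(repr x))%:F / (\d_(repr x))%:F.
  by rewrite -frac_numden.
move: (\n_(repr x)) (\d_(repr x)) d'0 => n' d' d'0 e.
apply/eqP; rewrite eqr_div ?tofrac_eq0 ?expf_neq0 // -!tofracM tofrac_eq.
have := congr1 D e; rewrite !DM => e'.
(* The left side is written in terms of n' d and D(n' d), to which the relation and its derivative
   apply. *)
apply/eqP; transitivity ((D n' * d + n' * D d) * (d * d') - (n' * d) * (D d * d' + d * D d')).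
  by ring.
by rewrite -e' -e; ring.
Qed.

Lemma frac_der_tofrac n : frac_der n%:F = (D n)%:F.
Proof.
rewrite -[n%:F]divr1 -tofrac1 frac_der_div ?oner_neq0 //.
by rewrite D1 mulr0 subr0 mulr1 expr1n tofrac1 divr1.
Qed.

Lemma frac_derB : zmod_morphism frac_der.
Proof.
move=> x y; have [a [b [b0 ->]]] := fracP x; have [c [d [d0 ->]]] := fracP y.
have -> : a%:F / b%:F - c%:F / d%:F = (a * d - c * b)%:F / (b * d)%:F.
  rewrite -mulNr addf_div ?tofrac_eq0 //.
  by rewrite tofracM tofracB !tofracM mulNr.
rewrite !frac_der_div ?mulf_neq0 // DB !DM.
rewrite -[- (_%:F / _)]mulNr addf_div ?tofrac_eq0 ?expf_neq0 //.
rewrite -tofracN -!tofracM -tofracD exprMn; congr (_%:F / _); by ring.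
Qed.

Lemma frac_derM x y : frac_der (x * y) = frac_der x * y + x * frac_der y.
Proof.
have [a [b [b0 ->]]] := fracP x; have [c [d [d0 ->]]] := fracP y.
rewrite mulf_div -!tofracM !frac_der_div ?mulf_neq0 // !mulf_div -!tofracM.
rewrite addf_div ?tofrac_eq0 ?mulf_neq0 ?expf_neq0 // -!tofracM -tofracD !DM.
apply/eqP; rewrite eqr_div ?tofrac_eq0 ?mulf_neq0 ?expf_neq0 ?mulf_neq0 //.
by rewrite -!tofracM tofrac_eq; apply/eqP; ring.
Qed.

End Derivation.
End FractionField.

Lemma pchar0_ratfun s : [pchar (ratfun s)] =i pred0.
Proof.
move=> p; apply/negbTE/negP => /andP [p_pr].
rewrite -tofrac1 -(rmorphMn (@FracField.tofrac _)) tofrac_eq0.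
rewrite -mpolyC1 -(rmorphMn (@mpolyC s rat)) mpolyC_eq0 Num.Theory.pnatr_eq0 => /eqP p0.
by rewrite p0 in p_pr.
Qed.

Definition Xf {s} (i : 'I_s) : ratfun s := FracField.tofrac 'X_i.

Lemma mev_Xf s p : mev (@Xf s) p = FracField.tofrac p :> ratfun s.
Proof.
have cM := @pchar0_ratfun s.
elim/mpoly_rmorph_ind: p => [c|i|p q Hp Hq|p q Hp Hq].
- by rewrite mevC // -(fmorph_eq_rat (@FracField.tofrac _ \o @mpolyC s rat)).
- by rewrite mevX.
- by rewrite mevD // Hp Hq tofracD.
- by rewrite mevM // Hp Hq tofracM.
Qed.

(** * Specialisation of rational functions *)

Section Specialisation.
Variables (K : fieldType) (charK : [pchar K] =i pred0) (s : nat).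
Implicit Types (x : 'I_s -> K) (m : ratfun s) (k : K).
Local Notation "p %:F" := (@FracField.tofrac _ p).

(** Cross-multiplying two fractions for [m] gives a polynomial identity, which is evaluated at [x].
    Equalities in [K] can thus be proved by specialising one rational function in two ways. *)
Lemma spec_coef_inj x m k k' : spec_coef x m k -> spec_coef x m k' -> k = k'.
Proof.
case=> [n [d [d0 -> ->]]] [n' [d' [d'0 e ->]]].
have nz p : mev x p != 0 -> p != 0.
  by apply: contraNneq => ->; rewrite mev_0.
apply/eqP; rewrite eqr_div // -!mevM //; apply/eqP; congr mev.
by apply: frac_eq e; apply: nz.
Qed.

Lemma spec_coef_tofrac x p : spec_coef x p%:F (mev x p).
Proof.
by exists p, 1; rewrite mev1 // tofrac1 !divr1; split=> //; apply: oner_neq0.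
Qed.

Lemma spec_coefX x i : spec_coef x (Xf i) (x i).
Proof. by have := spec_coef_tofrac x 'X_i; rewrite mevX. Qed.

Let nz x p : mev x p != 0 -> p%:F != 0 :> ratfun s.
Proof. by rewrite tofrac_eq0; apply: contraNneq => ->; rewrite mev_0. Qed.

Lemma spec_coefD x m m' k k' :
  spec_coef x m k -> spec_coef x m' k' -> spec_coef x (m + m') (k + k').
Proof.
case=> [n [d [d0 -> ->]]] [n' [d' [d'0 -> ->]]].
exists (n * d' + n' * d), (d * d'); split; rewrite ?mevM ?mulf_neq0 //.
  by rewrite tofracD !tofracM (addf_div _ _ (nz d0) (nz d'0)).
by rewrite addf_div // mevD // !mevM.
Qed.

Lemma spec_coefM x m m' k k' :
  spec_coef x m k -> spec_coef x m' k' -> spec_coef x (m * m') (k * k').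
Proof.
case=> [n [d [d0 -> ->]]] [n' [d' [d'0 -> ->]]].
exists (n * n'), (d * d'); split; rewrite ?mevM ?mulf_neq0 //.
  by rewrite mulf_div !tofracM.
by rewrite mulf_div.
Qed.

Lemma spec_coefN x m k : spec_coef x m k -> spec_coef x (- m) (- k).
Proof.
case=> [n [d [d0 -> ->]]]; exists (- n), d; split=> //.
  by rewrite tofracN mulNr.
by rewrite mevN // mulNr.
Qed.

Lemma spec_coefB x m m' k k' :
  spec_coef x m k -> spec_coef x m' k' -> spec_coef x (m - m') (k - k').
Proof. by move=> h /spec_coefN; apply: spec_coefD. Qed.

Lemma spec_coefV x m k : k != 0 -> spec_coef x m k -> spec_coef x m^-1 k^-1.
Proof.
move=> k0 [n [d [d0 -> e]]]; have n0 : mev x n != 0.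
  by apply: contraNneq k0 => e0; rewrite e e0 mul0r.
by exists d, n; split=> //; rewrite ?e invf_div.
Qed.

Lemma spec_coef_div x m m' k k' : k' != 0 ->
  spec_coef x m k -> spec_coef x m' k' -> spec_coef x (m / m') (k / k').
Proof. by move=> k0 h h'; apply: spec_coefM => //; apply: spec_coefV. Qed.

Lemma spec_coef0 x : spec_coef x 0 0.
Proof. by have := spec_coef_tofrac x 0; rewrite tofrac0 mev_0. Qed.

Lemma spec_coef1 x : spec_coef x 1 1.
Proof. by have := spec_coef_tofrac x 1; rewrite tofrac1 mev1. Qed.

Lemma spec_coef_nat x n : spec_coef x n%:R n%:R.
Proof.
elim: n => [|n IH]; first exact: spec_coef0.
by rewrite -!natr1; apply: spec_coefD => //; apply: spec_coef1.
Qed.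

Lemma spec_coef_ratr x q : spec_coef x (ratr q) (ratr q).
Proof.
have := spec_coef_tofrac x q%:MP; rewrite mevC //.
by rewrite -mev_Xf mevC //; apply: pchar0_ratfun.
Qed.

(** Reduces nonvanishing in the function field to a numerical check at one point. *)
Lemma spec_coef_neq0 x m k : spec_coef x m k -> k != 0 -> m != 0.
Proof.
move=> h; apply: contraNneq => e; apply/eqP.
by apply: spec_coef_inj h _; rewrite e; apply: spec_coef0.
Qed.

Lemma eq_spec_coef x y m k : x =1 y -> spec_coef x m k -> spec_coef y m k.
Proof.
move=> e [n [d [d0 em ek]]]; exists n, d.
by rewrite -!(eq_mev e).
Qed.

Lemma spec_coef_mev t (theta : 'I_t -> ratfun s) (tau : 'I_t -> K) x p :
  (forall i, spec_coef x (theta i) (tau i)) ->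
  spec_coef x (mev theta p) (mev tau p).
Proof.
move=> h; have cM := @pchar0_ratfun s.
elim/mpoly_rmorph_ind: p => [c|i|p q Hp Hq|p q Hp Hq].
- by rewrite !mevC //; apply: spec_coef_ratr.
- by rewrite !mevX.
- by rewrite !mevD //; apply: spec_coefD.
- by rewrite !mevM //; apply: spec_coefM.
Qed.
End Specialisation.

Lemma spec_coef_generic s (m : ratfun s) :
  exists2 h : {mpoly rat[s]}, h != 0 &
    forall (K : fieldType), [pchar K] =i pred0 -> forall x : 'I_s -> K,
      mev x h != 0 -> exists2 k, spec_coef x m k & (m != 0 -> k != 0).
Proof.
have [n [d [d0 ->]]] := fracP m.
(* The numerator enters only when it is nonzero, so that [h] stays nonzero when [m = 0]. *)
exists (d * (if n == 0 then 1 else n)).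
  by rewrite mulf_neq0 //; case: ifP => [_|/negbT //]; apply: oner_neq0.
move=> K cK x; rewrite mevM // mulf_eq0 negb_or => /andP [dx nx].
exists (mev x n / mev x d); first by exists n, d.
rewrite mulf_eq0 negb_or tofrac_eq0 => /andP [/negbTE n0 _].
by rewrite n0 in nx; rewrite mulf_neq0 // invr_eq0.
Qed.

Lemma spec_coef_generic_seq s (r : seq (ratfun s)) :
  exists2 h : {mpoly rat[s]}, h != 0 &
    forall (K : fieldType), [pchar K] =i pred0 -> forall x : 'I_s -> K,
      mev x h != 0 -> forall m, m \in r ->
      exists2 k, spec_coef x m k & (m != 0 -> k != 0).
Proof.
elim: r => [|m r [h h0 hP]]; first by exists 1; rewrite ?oner_neq0.
have [h' h'0 h'P] := spec_coef_generic m.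
exists (h' * h); first exact: mulf_neq0.
move=> K cK x; rewrite mevM // mulf_eq0 negb_or => /andP [h'x hx] m'.
by rewrite inE => /orP [/eqP ->|]; [apply: h'P | apply: hP].
Qed.

(** Uniqueness of base [B] digits: the lowest digit is read modulo [B], the others after cancelling
    a factor [B]. *)
Lemma sum_expn_inj B n (f g : 'I_n -> nat) :
  (forall i, f i < B)%N -> (forall i, g i < B)%N ->
  (\sum_i f i * B ^ i = \sum_i g i * B ^ i)%N -> f =1 g.
Proof.
elim: n f g => [|n IH] f g fB gB; first by move=> _ [].
rewrite !big_ord_recl !expn0 !muln1.
have E h : (\sum_(i < n) h (lift ord0 i) * B ^ lift ord0 i
   = (\sum_(i < n) h (lift ord0 i) * B ^ i) * B)%N.
  by rewrite big_distrl; apply: eq_bigr => i _; rewrite /= expnSr mulnA.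
rewrite !E => e.
have B0 : (0 < B)%N by apply: leq_ltn_trans (fB ord0).
have e0 : f ord0 = g ord0.
  have := congr1 (modn^~ B) e; rewrite !modnDr || rewrite !(addnC _ (_ * B)%N).
  by rewrite !modnMDl !modn_small.
have /IH eS : (\sum_(i < n) f (lift ord0 i) * B ^ i =
               \sum_(i < n) g (lift ord0 i) * B ^ i)%N.
  by apply/eqP; rewrite -(eqn_pmul2r B0) -(eqn_add2l (f ord0)) e e0.
move=> i; case: (unliftP ord0 i) => [j|] -> //.
by apply: eS => {}j.
Qed.

(* Kronecker substitution: X_i is sent to T^(B^i) for B large. *)
Lemma mpoly_nat_neq0 (K : fieldType) n (p : {mpoly K[n]}) :
  [pchar K] =i pred0 -> p != 0 ->
  exists k : 'I_n -> nat, p.@[fun i => (k i)%:R] != 0.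
Proof.
move=> /pcharf0P cK p0; pose B := msize p.
pose kappa (m : 'X_{1..n}) := (\sum_(i < n) m i * B ^ i)%N.
pose q : {poly K} := \sum_(m <- msupp p) p@_m *: 'X^(kappa m).
have mB m : m \in msupp p -> forall i, (m i < B)%N.
  move=> /msize_mdeg_lt mp i; apply: leq_ltn_trans mp.
  by rewrite mdegE (bigD1 i) //= leq_addr.
have kinj : {in msupp p &, injective kappa}.
  move=> m m' mp m'p /sum_expn_inj e; apply/mnmP; apply: e; exact: mB.
have [m0 m0p] : exists m0, m0 \in msupp p.
  by exists (mlead p); rewrite mlead_supp.
have q0 : q != 0.
  apply/eqP => /(congr1 (fun r : {poly K} => r`_(kappa m0))).
  rewrite coef0 /q coef_sum (bigD1_seq m0) ?msupp_uniq //= big1_seq.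
    by rewrite addr0 coefZ coefXn eqxx mulr1 => /eqP; rewrite mcoeff_eq0 m0p.
  move=> m /andP [mm0 mp]; rewrite coefZ coefXn.
  have -> : (kappa m0 == kappa m) = false; last by rewrite mulr0.
  by apply: contraNF mm0 => /eqP /kinj ->.
(* A nonzero [q] has fewer than [size q] roots, so one of these [size q] integers, distinct in
   characteristic zero, is not a root. *)
pose rs : seq K := [seq i%:R | i <- iota 0 (size q)].
have urs : uniq rs.
  rewrite map_inj_uniq ?iota_uniq // => i j /eqP.
  wlog le : i j / (i <= j)%N.
    by move=> W; case/orP: (leq_total i j) => ij; last rewrite eq_sym => e;
       [|apply/esym; move: e]; apply: W.
  rewrite -subr_eq0 -opprB oppr_eq0 -natrB // cK subn_eq0 => ji.
  by apply/eqP; rewrite eqn_leq le.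
have : ~~ all (root q) rs.
  apply/negP => /(max_poly_roots q0)/(_ urs).
  by rewrite size_map size_iota ltnn.
case/allPn => _ /mapP [c _ ->] qc.
exists (fun i => c ^ (B ^ i))%N; apply: contra qc => /eqP pc.
rewrite rootE; apply/eqP; apply: etrans pc.
rewrite /q horner_sum mevalE; apply: eq_bigr => m _.
rewrite hornerZ hornerXn -natrX /kappa expn_sum natr_prod; congr (_ * _).
by apply: eq_bigr => i _; rewrite mulnC expnM !natrX.
Qed.

(** * Artin's theorem *)

(** Newton's form: a new node [x] is met by adding a multiple of the product of the ['X - y] over
    the other nodes, which vanishes at them but not at [x]. *)
Lemma interpolation (M : fieldType) (r : seq M) (v : M -> M) : uniq r ->
  exists2 q : {poly M}, (size q <= size r)%N & {in r, forall x, q.[x] = v x}.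
Proof.
elim: r => [|x r IH] /=; first by exists 0; rewrite ?size_poly0.
case/andP => xr /IH [q sq qv].
pose p := \prod_(y <- r) ('X - y%:P).
have px : p.[x] != 0.
  by have := root_prod_XsubC r x; rewrite (negbTE xr) rootE => ->.
exists (q + ((v x - q.[x]) / p.[x]) *: p).
  rewrite (leq_trans (size_polyD _ _)) // geq_max (leq_trans sq) //=.
  by rewrite (leq_trans (size_scale_leq _ _)) // size_prod_XsubC.
move=> y; rewrite inE => /orP [/eqP ->|yr].
  by rewrite hornerD hornerZ divfK // addrC subrK.
rewrite hornerD hornerZ qv //.
have /eqP -> : root p y by rewrite root_prod_XsubC.
by rewrite mulr0 addr0.
Qed.

Lemma interpolation_uniq (M : fieldType) (r : seq M) (p q : {poly M}) :
  uniq r -> (size p <= size r)%N -> (size q <= size r)%N ->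
  {in r, forall x, p.[x] = q.[x]} -> p = q.
Proof.
move=> ur sp sq e; apply/eqP; rewrite -subr_eq0; apply: contraT => pq0.
have : (size r < size (p - q)%R)%N.
  apply: max_poly_roots => //; apply/allP => x /e xe.
  by rewrite rootE hornerD hornerN xe subrr.
by rewrite ltnNge (leq_trans (size_polyD _ _)) // size_polyN geq_max sp sq.
Qed.

Section Artin.
Variables (F M : fieldType) (phi : {rmorphism F -> M}).
Variables (gT : finGroupType) (G : {group gT}) (psi : gT -> {rmorphism M -> M}).
Hypothesis psiM : {in G &, forall g h m, psi (g * h)%g m = psi h (psi g m)}.
Hypothesis psi_phi : {in G, forall g f, psi g (phi f) = phi f}.
Hypothesis psi_fixed :
  forall m, {in G, forall g, psi g m = m} -> exists f, m = phi f.
Variable z : M.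
Hypothesis z_inj : {in G &, injective (fun g => psi g z)}.

(** By [psiM] the map [psi 1] is idempotent, and a field morphism is injective. *)
Let psi1 m : psi 1%g m = m.
Proof. by apply: (fmorph_inj (psi 1%g)); rewrite -psiM ?mulg1 ?group1. Qed.

Lemma fixed_poly (q : {poly M}) :
  {in G, forall g, map_poly (psi g) q = q} -> exists r, q = map_poly phi r.
Proof.
move=> qG; have h (i : 'I_(size q)) : exists f, q`_i = phi f.
  apply: psi_fixed => g /qG /(congr1 (fun p : {poly M} => p`_i)).
  by rewrite coef_map.
have [f fP] := fin_all_exists h.
exists (\poly_(i < size q) (if insub i is Some j then f j else 0)).
apply/polyP => i; rewrite coef_map coef_poly.
case: ltnP => [iq|iq]; last by rewrite raddf0 nth_default.
by rewrite insubT /= -fP.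
Qed.

Definition conjugates := [seq psi g z | g <- enum G].

Lemma conjugates_uniq : uniq conjugates.
Proof.
rewrite map_inj_in_uniq ?enum_uniq // => g h.
by rewrite !mem_enum; apply: z_inj.
Qed.

Lemma size_conjugates : size conjugates = #|G|.
Proof. by rewrite size_map -cardE. Qed.

Lemma mem_conjugates g : g \in G -> psi g z \in conjugates.
Proof. by move=> gG; apply: map_f; rewrite mem_enum. Qed.

Lemma root_conjugates (q : {poly F}) :
  root (map_poly phi q) z -> all (root (map_poly phi q)) conjugates.
Proof.
move=> /rootP qz; apply/allP => _ /mapP [g gG ->]; rewrite mem_enum in gG.
rewrite rootE.
have -> : map_poly phi q = map_poly (psi g) (map_poly phi q).
  by rewrite -map_poly_comp; apply: eq_map_poly => f /=; rewrite psi_phi.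
by rewrite horner_map qz rmorph0.
Qed.

(** Each [psi g] permutes the conjugates of [z], so the coefficients of the product are
    invariant. *)
Lemma prod_conjugatesE : exists P : {poly F},
  map_poly phi P = \prod_(x <- conjugates) ('X - x%:P).
Proof.
have [|P ->] := @fixed_poly (\prod_(x <- conjugates) ('X - x%:P)); last by exists P.
move=> g gG; rewrite rmorph_prod /=.
rewrite (eq_bigr (fun x => 'X - (psi g x)%:P)); last first.
  by move=> x _; rewrite rmorphB /= map_polyX map_polyC.
apply: etrans (esym _) _; first exact: (big_map (psi g) predT (fun x => 'X - x%:P)).
apply: perm_big.
have u : uniq (map (psi g) conjugates).
  by rewrite map_inj_uniq ?conjugates_uniq //; apply: fmorph_inj.
apply: uniq_perm; rewrite ?conjugates_uniq //.
apply: (uniq_min_size u _ _).2; rewrite ?size_map // => _ /mapP [_ /mapP [h hG ->] ->].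
by rewrite mem_enum in hG; rewrite -psiM // mem_conjugates ?groupM.
Qed.

(** Let [q] be the interpolation polynomial taking each [psi g z] to [psi g m]. Applying an element
    of [G] to its coefficients gives a polynomial with the same values, so by uniqueness [q] has
    coefficients in [F]. *)
Lemma conjugates_generate m : exists q : {poly F}, (map_poly phi q).[z] = m.
Proof.
pose v (x : M) := if [pick g in G | psi g z == x] is Some g then psi g m else 0.
have vE g : g \in G -> v (psi g z) = psi g m.
  move=> gG; rewrite /v; case: pickP => [h /andP [hG /eqP /z_inj ->] //|].
  by move/(_ g); rewrite gG eqxx.
have [q sq qv] := interpolation v conjugates_uniq.
have [|r qr] := @fixed_poly q; last first.
  by exists r; rewrite -qr -[z]psi1 qv ?mem_conjugates // vE ?psi1.
move=> g gG; apply: (interpolation_uniq conjugates_uniq) => //.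
  by rewrite size_map_poly.
move=> _ /mapP [h hG ->]; rewrite mem_enum in hG.
have kG : (h * g^-1)%g \in G by rewrite groupM ?groupV.
rewrite -{1}(mulgKV g h) psiM // horner_map qv ?mem_conjugates // vE //.
by rewrite -psiM // mulgKV -vE // qv ?mem_conjugates.
Qed.

(** [E] is F[X]/(P), embedded in [M] by sending the class [w] of X to [z]; the embedding is onto, so
    [P] splits in [E]. An automorphism [s] moves [w] to some [psi (d s) z], and [d] is an
    isomorphism onto [G] by injectivity and a comparison of orders. *)
Theorem artin_splitting (P : {poly F}) :
  map_poly phi P = \prod_(x <- conjugates) ('X - x%:P) ->
  exists E : splittingFieldType F,
    splittingFieldFor 1%VS (map_poly (in_alg E) P) fullv /\
    ('Gal((fullv : {vspace E}) / 1%VS) \isog G)%g.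
Proof.
move=> PE.
have sP : size P = #|G|.+1.
  by rewrite -(size_map_poly phi) PE size_prod_XsubC size_conjugates.
have P0 : P != 0 by rewrite -size_poly_eq0 sP.
have Pm : P \is monic by rewrite -(map_monic phi) PE monic_prod_XsubC.
have Pz : root (map_poly phi P) z.
  by rewrite PE root_prod_XsubC -[z]psi1 mem_conjugates.
(* A nonzero polynomial vanishing at [z] vanishes at all [#|G|] conjugates, so it is no shorter than
   [P]. *)
have irrP : irreducible_poly P.
  apply/(subfx_irreducibleP Pz P0) => q qz q0.
  rewrite sP -size_conjugates -(size_map_poly phi).
  by apply: max_poly_roots; rewrite ?map_poly_eq0 ?root_conjugates ?conjugates_uniq.
pose E0 : fieldExtType F := SubFieldExtType Pz irrP.
pose inj : {rmorphism E0 -> M} := @subfx_inj F M phi z P.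
have inj_base a : inj (a%:A) = phi a by exact: (subfx_inj_base Pz P0).
have inj_root : inj (subfx_root phi z P) = z by exact: (subfx_inj_root Pz P0).
pose w : E0 := subfx_root phi z P.
have map_inj q : map_poly inj (map_poly (in_alg E0) q) = map_poly phi q.
  by rewrite -map_poly_comp; apply: eq_map_poly => a /=; apply: inj_base.
(* [z] generates [M] over [F]; this pulls all the conjugates of [z] back into [E0]. *)
have surj m : exists e : E0, inj e = m.
  have [q <-] := conjugates_generate m; exists (map_poly (in_alg E0) q).[w].
  by rewrite -horner_map map_inj inj_root.
have [c cP] : exists c : gT -> E0, forall g, inj (c g) = psi g z.
  exact: (fin_all_exists (fun g => surj (psi g z))).
pose r := [seq c g | g <- enum G].
have rE : map inj r = conjugates.
  by rewrite -map_comp; apply: eq_map => g /=; apply: cP.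
have ur : uniq r by rewrite -(map_inj_uniq (fmorph_inj inj)) rE conjugates_uniq.
have PrE : map_poly (in_alg E0) P = \prod_(x <- r) ('X - x%:P).
  apply: (map_poly_inj inj); rewrite map_inj PE -rE rmorph_prod big_map.
  by apply: eq_bigr => x _; rewrite rmorphB /= map_polyX map_polyC.
have gen : <<1; w>>%VS = fullv :> {vspace E0}.
  apply/vspaceP => x; rewrite memvf; apply/Fadjoin_polyP.
  have [q qE] := subfxEroot Pz P0 x; exists (map_poly (in_alg E0) q) => //.
  by apply/polyOverP => i; rewrite coef_map memvZ ?mem1v.
have wr : w \in r.
  apply/mapP; exists 1%g; rewrite ?mem_enum ?group1 //.
  by apply: (fmorph_inj inj); rewrite cP psi1 inj_root.
have splitP : splittingFieldFor 1%VS (map_poly (in_alg E0) P) (fullv : {vspace E0}).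
  exists r; first by rewrite PrE eqpxx.
  apply/eqP; rewrite eqEsubv subvf -gen; apply/FadjoinP; rewrite subv_adjoin_seq.
  by split=> //; apply: seqv_sub_adjoin.
have Pover : map_poly (in_alg E0) P \is a polyOver 1%VS.
  by apply/polyOverP => i; rewrite coef_map memvZ ?mem1v.
have ax : splitting_field_axiom E0 by exists (map_poly (in_alg E0) P).
pose E : splittingFieldType F := HB.pack E0 (FieldExt_isSplittingField.Build F E0 ax).
exists E; split; first exact: splitP.
have galE : galois (1%VS : {vspace E}) (fullv : {vspace E}).
  apply/splitting_galoisField; exists (map_poly (in_alg E0) P).
  by split=> //; rewrite PrE separable_prod_XsubC.
have cardE : #|('Gal((fullv : {vspace E}) / 1%VS))%g| = #|G|.
  apply: etrans (esym (galois_dim galE)) _; rewrite dimv1 divn1 dimvf.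
  by rewrite /dim /= sP.
pose Gal := galoisG_group (fullv : {vspace E}) 1%VS.
have gal_w (s : gal_of (fullv : {vspace E})) : exists2 g, g \in G & inj (s w) = psi g z.
  have : root (map_poly phi P) (inj (s w)).
    rewrite -map_inj fmorph_root -[w]/(w : E).
    have -> : map_poly (in_alg E0) P = map_poly s (map_poly (in_alg E0) P).
      rewrite -map_poly_comp; apply: eq_map_poly => a /=.
      by rewrite linearZ /= rmorph1.
    by rewrite fmorph_root PrE root_prod_XsubC.
  by rewrite PE root_prod_XsubC => /mapP [g gG ->]; rewrite mem_enum in gG; exists g.
have /fin_all_exists [d dP] (s : gal_of (fullv : {vspace E})) :
    exists g, g \in G /\ inj (s w) = psi g z.
  by have [g gG gE] := gal_w s; exists g.
have gal_psi (s : gal_of (fullv : {vspace E})) (m : E0) : inj (s m) = psi (d s) (inj m).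
  have [q ->] := subfxEroot Pz P0 m; have [dG dE] := dP s.
  have -> : s (map_poly (in_alg E0) q).[w] = (map_poly (in_alg E0) q).[s w].
    rewrite -horner_map -map_poly_comp; congr _.[_]; apply: eq_map_poly => a /=.
    by rewrite linearZ /= rmorph1.
  rewrite -!horner_map !map_inj dE inj_root /=; congr _.[_].
  by rewrite -map_poly_comp; apply: eq_map_poly => f /=; rewrite psi_phi.
(* The product of the Galois group satisfies (s * t) m = t (s m), the same order of composition as
   in [psiM]. *)
have dM : {in Gal &, {morph d : s t / (s * t)%g}}.
  move=> s t _ _; have [sG sE] := dP s; have [tG tE] := dP t.
  have [stG stE] := dP (s * t)%g.
  apply: z_inj; rewrite ?groupM // -stE psiM // -sE -gal_psi.
  by rewrite galM ?memvf.
pose f := Morphism dM.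
have injf : ('injm f)%g.
  apply/injmP => s t _ _ /= dst; apply/eqP/gal_eqP => m _.
  by apply: (fmorph_inj inj); rewrite !gal_psi dst.
apply: (@isog_trans _ _ _ _ (f @* Gal)%G); first by apply: sub_isog.
suff -> : (f @* Gal)%G = G by apply: isog_refl.
apply/val_inj/eqP; rewrite eqEcard card_injm //= cardE leqnn andbT.
by apply/subsetP => _ /morphimP [s _ _ ->]; have [] := dP s.
Qed.
End Artin.

(** * The signed permutation representation *)

(** One point serves all fields at once, since the value of [p] there is the image of a nonzero
    rational. *)
Lemma mev_generic s (p : {mpoly rat[s]}) : p != 0 ->
  exists k : 'I_s -> nat, forall K : fieldType, [pchar K] =i pred0 ->
    mev (fun i => (k i)%:R : K) p != 0.
Proof.
move=> p0; have cQ : [pchar rat] =i pred0 by apply: Num.Theory.pchar_num.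
have [k kp] := mpoly_nat_neq0 cQ p0; exists k => K cK.
have e : mev (fun i => (k i)%:R : rat) p = p.@[fun i => (k i)%:R].
  rewrite /mev /meval; apply: eq_bigr => m _; congr (_ * _).
  by rewrite -(fmorph_eq_rat (idfun : {rmorphism rat -> rat})).
have e2 : ratr0 cK \o (fun i => (k i)%:R) =1 (fun i => (k i)%:R : K).
  by move=> i; apply: (rmorph_nat (ratr0 cK)).
have := fmorph_mev (ratr0 cK) (fun i => (k i)%:R : rat) p.
rewrite (eq_mev e2).
by move=> <-; rewrite e (fmorph_eq0 (ratr0 cK)).
Qed.

(** * Substitution of algebraically independent elements *)

Section Substitution.
Variables (s t : nat) (theta : 'I_t -> ratfun s).
Let cM := @pchar0_ratfun s.

Hypothesis theta_inj : injective (mev0 cM theta).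

Definition subst : ratfun t -> ratfun s := frac_lift theta_inj.
HB.instance Definition _ := GRing.RMorphism.on subst.

Lemma substX i : subst (Xf i) = theta i.
Proof. by rewrite /subst /Xf frac_lift_tofrac; exact: mevX. Qed.

Lemma spec_coef_subst (K : fieldType) (x : 'I_s -> K) (tau : 'I_t -> K) f k :
  [pchar K] =i pred0 -> (forall i, spec_coef x (theta i) (tau i)) ->
  spec_coef tau f k -> spec_coef x (subst f) k.
Proof.
move=> cK h [n [d [d0 -> ->]]].
have d1 : d != 0 by apply: contraNneq d0 => ->; rewrite mev_0.
rewrite /subst frac_lift_div //.
by apply: spec_coef_div => //; apply: spec_coef_mev.
Qed.
End Substitution.

Lemma mev0_injP s t (theta : 'I_t -> ratfun s) :
  (forall p, mev theta p = 0 -> p = 0) ->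
  injective (mev0 (@pchar0_ratfun s) theta).
Proof.
by move=> h p q /eqP; rewrite -subr_eq0 -rmorphB => /eqP /h /eqP; rewrite subr_eq0 => /eqP.
Qed.

Lemma ratfun_ext s (L : fieldType) (f g : {rmorphism ratfun s -> L}) :
  (forall i, f (Xf i) = g (Xf i)) -> f =1 g.
Proof.
move=> e m; have [n [d [d0 ->]]] := fracP m.
rewrite !fmorph_div -!mev_Xf !fmorph_mev.
by congr (_ / _); apply: eq_mev.
Qed.

Section SignedPermutations.

Lemma F3P (a : 'F_3) : [\/ a = 0, a = 1 | a = -1].
Proof.
case: a => [[|[|[|a]]]] // ia; [constructor 1|constructor 2|constructor 3];
  exact: val_inj.
Qed.

(* One representative in each pair {v, -v} of nonzero vectors. *)
Definition rep (j : 'I_4) : 'rV['F_3]_2 :=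
  \row_k (if k == 0 then nth 0 [:: 0; 1; 1; 1] j else nth 0 [:: 1; 0; 1; -1] j).

Section Vx.
Variable V : zmodType.
Implicit Type l : 'I_4 -> V.

Definition vx2 l (a b : 'F_3) : V :=
  if a == 0 then (if b == 0 then 0 else if b == 1 then l (inord 0) else - l (inord 0))
  else if a == 1 then
    (if b == 0 then l (inord 1) else if b == 1 then l (inord 2) else l (inord 3))
  else (if b == 0 then - l (inord 1) else if b == 1 then - l (inord 3) else - l (inord 2)).

(* Extends l from the representatives to an odd function on (F_3)^2. *)
Definition vx l (v : 'rV['F_3]_2) : V := vx2 l (v 0 0) (v 0 1).

Lemma vx_rep l j : vx l (rep j) = l j.
Proof.
rewrite /vx !mxE /=.
by case: j => [[|[|[|[|]]]] ij] //=; congr l; apply: val_inj; rewrite /= inordK.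
Qed.

Lemma vxN l v : vx l (- v) = - vx l v.
Proof.
rewrite /vx !mxE; case: (F3P (v 0 0)) => ->; case: (F3P (v 0 1)) => -> //=;
 by rewrite ?opprK ?oppr0.
Qed.

Lemma vx0 l : vx l 0 = 0.
Proof. by rewrite /vx !mxE. Qed.

Lemma rV2P (P : 'rV['F_3]_2 -> Prop) :
  P 0 -> (forall j, P (rep j)) -> (forall v, P v -> P (- v)) -> forall v, P v.
Proof.
move=> P0 Pr PN v.
have E (w : 'rV['F_3]_2) : v 0 0 = w 0 0 -> v 0 1 = w 0 1 -> v = w.
  move=> e0 e1; apply/rowP => i.
  case: i => [[|[|i]]] // ii.
    by rewrite (_ : Ordinal ii = 0) //; apply: val_inj.
  by rewrite (_ : Ordinal ii = 1) //; apply: val_inj.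
case: (F3P (v 0 0)) => v0; case: (F3P (v 0 1)) => v1.
- by rewrite (E 0) // ?v0 ?v1 mxE.
- by rewrite (E (rep (inord 0))) // ?v0 ?v1 mxE /= inordK.
- by rewrite (E (- rep (inord 0))) ?v0 ?v1 ?mxE /= ?inordK ?oppr0 //; apply: PN.
- by rewrite (E (rep (inord 1))) // ?v0 ?v1 mxE /= inordK.
- by rewrite (E (rep (inord 2))) // ?v0 ?v1 mxE /= inordK.
- by rewrite (E (rep (inord 3))) // ?v0 ?v1 mxE /= inordK.
- by rewrite (E (- rep (inord 1))) ?v0 ?v1 ?mxE /= ?inordK ?oppr0 //; apply: PN.
- by rewrite (E (- rep (inord 3))) ?v0 ?v1 ?mxE /= ?inordK ?opprK //; apply: PN.
- by rewrite (E (- rep (inord 2))) ?v0 ?v1 ?mxE /= ?inordK //; apply: PN.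
Qed.

(** Both sides are odd in [v] and agree on the representatives. *)
Lemma vx_mulmx l (g : 'M_2) v :
  vx (fun j => vx l (rep j *m g)) v = vx l (v *m g).
Proof.
move: v; apply: rV2P => [|j|v e]; first by rewrite mul0mx !vx0.
  by rewrite vx_rep.
by rewrite mulNmx !vxN e.
Qed.

Lemma eq_vx l l' : l =1 l' -> vx l =1 vx l'.
Proof. by move=> e v; rewrite /vx /vx2 !e. Qed.
End Vx.

Lemma raddf_vx (V W : zmodType) (f : {additive V -> W}) l v :
  f (vx l v) = vx (f \o l) v.
Proof.
by rewrite /vx /vx2; do ! case: ifP => _; rewrite /= ?raddfN ?raddf0.
Qed.

End SignedPermutations.

(** * Generation of SL_2(F_3) and its action on 4-tuples *)

Definition mx2 (a b c d : 'F_3) : 'M['F_3]_2 :=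
  \matrix_(i, j) (if i == 0 then if j == 0 then a else b
                  else if j == 0 then c else d).

Lemma mx2E (A : 'M['F_3]_2) : A = mx2 (A 0 0) (A 0 1) (A 1 0) (A 1 1).
Proof.
have E (i : 'I_2) : i = 0 \/ i = 1.
  by case: i => [[|[|i]]] // ii; [left|right]; apply: val_inj.
by apply/matrixP => i j; rewrite mxE; case: (E i) => ->; case: (E j) => ->.
Qed.

Lemma det_mx2 a b c d : \det (mx2 a b c d) = a * d - b * c.
Proof.
rewrite (expand_det_row _ 0) !big_ord_recl big_ord0 /cofactor !det_mx11 !mxE /=.
by rewrite expr0 expr1 mul1r mulN1r mulrN addr0.
Qed.

Lemma mul_mx2 a b c d a' b' c' d' :
  mx2 a b c d *m mx2 a' b' c' d' =
  mx2 (a * a' + b * c') (a * b' + b * d') (c * a' + d * c') (c * b' + d * d').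
Proof.
by rewrite [LHS]mx2E !mxE !big_ord_recl !big_ord0 !mxE /= !addr0.
Qed.

(** The transvections have order 3, so products alone yield all their powers. A matrix with lower
    left entry c != 0 is upper times lower times upper unitriangular; if c = 0, adding the first row
    to the second makes that entry nonzero. *)
Lemma SL2_ind (Q : 'M['F_3]_2 -> Prop) :
  Q (mx2 1 1 0 1) -> Q (mx2 1 0 1 1) ->
  (forall A B, Q A -> Q B -> Q (A *m B)) -> forall A, \det A = 1 -> Q A.
Proof.
move=> QU QL QM.
have F3 : (3%:R : 'F_3) = 0 by apply: val_inj.
have QUt t : Q (mx2 1 t 0 1).
  case: (F3P t) => ->; last 2 first.
  - exact: QU.
  - have := QM _ _ QU QU; rewrite mul_mx2; congr (Q (mx2 _ _ _ _)); exact: val_inj.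
  have := QM _ _ QU (QM _ _ QU QU); rewrite !mul_mx2.
  congr (Q (mx2 _ _ _ _)); exact: val_inj.
have QLt t : Q (mx2 1 0 t 1).
  case: (F3P t) => ->; last 2 first.
  - exact: QL.
  - have := QM _ _ QL QL; rewrite mul_mx2; congr (Q (mx2 _ _ _ _)); exact: val_inj.
  have := QM _ _ QL (QM _ _ QL QL); rewrite !mul_mx2.
  congr (Q (mx2 _ _ _ _)); exact: val_inj.
have Qc a b c d : c != 0 -> a * d - b * c = 1 -> Q (mx2 a b c d).
  move=> c0 e.
  have := QM _ _ (QUt ((a - 1) / c)) (QM _ _ (QLt c) (QUt ((d - 1) / c))).
  rewrite !mul_mx2; congr (Q (mx2 _ _ _ _)); try by field.
  by apply: (mulfI c0); apply: (addIr 1); rewrite -[in RHS]e; field.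
move=> A; rewrite [A]mx2E det_mx2; move: (A 0 0) (A 0 1) (A 1 0) (A 1 1) => a b c d.
have [->|] := eqVneq c 0; last exact: Qc.
rewrite mulr0 subr0 => ad.
have a0 : a != 0.
  by apply: contraTneq isT => a0; move/eqP: ad; rewrite a0 mul0r eq_sym oner_eq0.
have := QM _ _ (QLt (-1)) (@Qc a b a (b + d) a0 _).
rewrite mul_mx2; have -> : mx2 (1 * a + 0 * a) (1 * b + 0 * (b + d)) (-1 * a + 1 * a)
  (-1 * b + 1 * (b + d)) = mx2 a b 0 d by congr mx2; ring.
by apply; rewrite -ad; ring.
Qed.

Section Linear.
Variable V : zmodType.
Implicit Type l : 'I_4 -> V.

Definition lin l (A : 'M['F_3]_2) (j : 'I_4) : V := vx l (rep j *m A).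

Lemma lin_mulmx l A B : lin (lin l B) A =1 lin l (A *m B).
Proof. by move=> j; rewrite /lin vx_mulmx mulmxA. Qed.

Lemma lin1 l : lin l 1%:M =1 l.
Proof. by move=> j; rewrite /lin mulmx1 vx_rep. Qed.

Lemma eq_lin l l' A : l =1 l' -> lin l A =1 lin l' A.
Proof. by move=> e j; apply: eq_vx. Qed.

Lemma lin_mx2 l a b c d :
  [/\ lin l (mx2 a b c d) (inord 0) = vx2 l c d,
      lin l (mx2 a b c d) (inord 1) = vx2 l a b,
      lin l (mx2 a b c d) (inord 2) = vx2 l (a + c) (b + d) &
      lin l (mx2 a b c d) (inord 3) = vx2 l (a - c) (b - d)].
Proof.
rewrite /lin /vx !mxE !big_ord_recl !big_ord0 !mxE /= !inordK //=.
rewrite !mul0r !mul1r !add0r !addr0; split=> //.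
by rewrite !mulN1r.
Qed.
End Linear.

Lemma raddf_lin (V W : zmodType) (f : {additive V -> W}) l A j :
  f (lin l A j) = lin (f \o l) A j.
Proof. exact: raddf_vx. Qed.

Local Notation M := (ratfun 4).
Local Notation X := (@Xf 4).
Local Notation cM := (@pchar0_ratfun 4).

Lemma spec_coef_vx (K : fieldType) (x : 'I_4 -> K) v :
  [pchar K] =i pred0 -> spec_coef x (vx X v) (vx x v).
Proof.
move=> cK; rewrite /vx /vx2; do ! case: ifP => _;
  first [exact: (spec_coef0 cK) | exact: (spec_coefX cK)
        | exact: (spec_coefN cK (spec_coefX cK _ _))].
Qed.

Lemma spec_coef_lin (K : fieldType) (x : 'I_4 -> K) A j :
  [pchar K] =i pred0 -> spec_coef x (lin X A j) (lin x A j).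
Proof. exact: spec_coef_vx. Qed.

(** Every point [x] is [lin y g] for y = [lin x g^-1]; hence a polynomial killed by the substitution
    vanishes at all rational points. *)
Lemma lin_inj (g : {'GL_2['F_3]}) : injective (mev0 cM (lin X (GLval g))).
Proof.
apply: mev0_injP => p e; apply/eqP; apply: contraT => /mev_generic [k kp].
have cQ : [pchar rat] =i pred0 by apply: Num.Theory.pchar_num.
have := kp rat cQ; set x : 'I_4 -> rat := fun i => (k i)%:R.
pose y := lin x (GLval g^-1).
have h i : spec_coef y (lin X (GLval g) i) (x i).
  have -> : x i = lin y (GLval g) i; last exact: spec_coef_lin.
  rewrite /y lin_mulmx; have -> : GLval g *m GLval g^-1 = 1%:M.
    by rewrite -[RHS]/(GLval 1) -(mulgV g).
  by rewrite lin1.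
have := spec_coef_mev cQ p h; rewrite e => /(spec_coef_inj cQ (spec_coef0 cQ y)) <-.
by rewrite eqxx.
Qed.

Definition psi (g : {'GL_2['F_3]}) : {rmorphism M -> M} := subst (@lin_inj g).

Lemma psi_X g i : psi g (X i) = lin X (GLval g) i.
Proof. exact: substX. Qed.

(** Composing substitutions reverses the order of the action [lin] on tuples, which is why [psi h]
    is applied last. *)
Lemma psiM g h m : psi (g * h)%g m = psi h (psi g m).
Proof.
pose f : {rmorphism M -> M} := psi h \o psi g.
apply: (ratfun_ext (f := psi (g * h)%g) (g := f)) => i.
apply: etrans (psi_X _ _) _; apply: etrans _ (esym (congr1 (psi h) (psi_X g i))).
apply: etrans _ (esym (raddf_lin (psi h) X (GLval g) i)).
apply: etrans _ (esym (eq_lin (GLval g) (psi_X h) i)).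
exact: esym (lin_mulmx X (GLval g) (GLval h) i).
Qed.

Lemma spec_coef_psi (K : fieldType) (x : 'I_4 -> K) (g : {'GL_2['F_3]}) (f : M) k :
  [pchar K] =i pred0 -> spec_coef (lin x (GLval g)) f k -> spec_coef x (psi g f) k.
Proof.
move=> cK; apply: spec_coef_subst => // i; exact: spec_coef_lin.
Qed.

Lemma SL2F3_group_set : group_set SL2F3.
Proof.
apply/group_setP; split; first by rewrite inE det1.
by move=> g h; rewrite !inE => /eqP dg /eqP dh; rewrite det_mulmx dg dh mulr1.
Qed.
Definition SL2F3_group := Group SL2F3_group_set.

(** A single indeterminate has a stabiliser of order 3. An element preserving the pair of vectors
    (1, 1), (1, -1) is trivial or swaps them, and the swap has determinant -1. *)
Definition zM : M := X (inord 2) + X (inord 3).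

(** Specialising at the point (0, 0, 1, 1) turns the equation into an equality of integers, which is
    tested on all matrices. *)
Lemma psi_zM g : g \in SL2F3 -> psi g zM = zM -> g = 1%g.
Proof.
rewrite inE => /eqP dg e.
have cQ : [pchar rat] =i pred0 by apply: Num.Theory.pchar_num.
pose m (i : 'I_4) : int := (1 < i)%N; pose x : 'I_4 -> rat := intr \o m.
have h : spec_coef x (psi g zM) (x (inord 2) + x (inord 3)).
  by rewrite e; apply: spec_coefD => //; apply: spec_coefX.
have h' : spec_coef x (psi g zM)
    (lin x (GLval g) (inord 2) + lin x (GLval g) (inord 3)).
  by apply: spec_coef_psi => //; apply: spec_coefD => //; apply: spec_coefX.
have := spec_coef_inj cQ h h'; rewrite -!raddf_lin -!rmorphD => /intr_inj.
move: dg; have := mx2E (GLval g); set A := GLval g => AE.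
rewrite AE det_mx2; have [_ _ -> ->] := lin_mx2 m (A 0 0) (A 0 1) (A 1 0) (A 1 1).
move=> dA mA; have {dA mA} : [/\ A 0 0 = 1, A 0 1 = 0, A 1 0 = 0 & A 1 1 = 1].
  move: (A 0 0) (A 0 1) (A 1 0) (A 1 1) dA mA => a b c d.
  rewrite /vx2 /m !inordK // => dA mA.
  pose s : seq 'F_3 := [:: 0; 1; -1].
  have sP (t : 'F_3) : t \in s by case: (F3P t) => ->.
  (* A computable form of [vx2 m]: only vectors with both entries nonzero have a nonzero value. *)
  pose w (a b : 'F_3) : int := if a == 0 then 0 else if a == 1 then (b != 0)%:R
    else - (b != 0)%:R.
  have /allP/(_ a (sP a))/allP/(_ b (sP b))/allP/(_ c (sP c))/allP/(_ d (sP d)) :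
    all (fun a => all (fun b => all (fun c => all (fun d =>
      (a * d - b * c == 1) ==> (2 == w (a + c) (b + d) + w (a - c) (b - d)) ==>
      [&& a == 1, b == 0, c == 0 & d == 1]) s) s) s) s by vm_compute.
  have -> : a * d - b * c == 1 by rewrite dA.
  have -> : 2 == w (a + c) (b + d) + w (a - c) (b - d).
    apply/eqP; apply: etrans mA _; rewrite /w.
    by congr (_ + _); do ! (case: ifP => ? //).
  by case/and4P => /eqP -> /eqP -> /eqP -> /eqP ->.
case=> a b c d; apply: val_inj; rewrite /= -/A AE a b c d.
by apply/matrixP => i j; rewrite !mxE; case: i => [[|[|?]]] ?; case: j => [[|[|?]]] ?.
Qed.

(** * Derivations and algebraic independence *)

Definition derivation (M : fieldType) (D : M -> M) :=
  zmod_morphism D /\ forall x y, D (x * y) = D x * y + x * D y.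

Section Derivations.
Variables (M : fieldType) (charM : [pchar M] =i pred0) (D : M -> M).
Hypothesis Dder : derivation D.
Let DB := Dder.1.
Let DM := Dder.2.

Lemma der0 : D 0 = 0. Proof. by rewrite -[0 in LHS](subrr 0) DB subrr. Qed.
Lemma derN x : D (- x) = - D x. Proof. by rewrite -sub0r DB der0 sub0r. Qed.
Lemma derD x y : D (x + y) = D x + D y.
Proof. by rewrite -[y in LHS]opprK DB derN opprK. Qed.
Lemma derB x y : D (x - y) = D x - D y. Proof. exact: DB. Qed.
Lemma derM x y : D (x * y) = D x * y + x * D y. Proof. exact: DM. Qed.
Lemma der1 : D 1 = 0.
Proof.
by apply: (addrI (D 1)); rewrite addr0 -[RHS](congr1 D (mulr1 1)) DM mulr1 mul1r.
Qed.
Lemma derMn x n : D (x *+ n) = D x *+ n.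
Proof. by elim: n => [|n IH]; rewrite ?mulr0n ?der0 // !mulrS derD IH. Qed.
Lemma derX2 x : D (x ^+ 2) = (x * D x) *+ 2.
Proof. by rewrite expr2 derM; ring. Qed.
Lemma der_div x y : y != 0 -> D (x / y) = (D x * y - x * D y) / y ^+ 2.
Proof.
move=> y0; have := derM (x / y) y; rewrite divfK // => ->.
by field.
Qed.
Lemma der_int (a : int) : D a%:~R = 0.
Proof.
have Dn n : D n%:R = 0 by rewrite derMn der1 mul0rn.
by case: a => n; [exact: Dn | rewrite NegzE mulrNz derN -[_%:~R]/(_%:R) Dn oppr0].
Qed.
Lemma der_ratr q : D (ratr q) = 0.
Proof.
rewrite /ratr der_div; last by rewrite pchar0_intr_eq0 ?denq_neq0.
by rewrite !der_int mul0r mulr0 subr0 mul0r.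
Qed.

Lemma der_mev t (theta : 'I_t -> M) p :
  D (mev theta p) = \sum_i mev theta p^`M(i) * D (theta i).
Proof.
elim/mpoly_rmorph_ind: p => [c|i|p q Hp Hq|p q Hp Hq].
- rewrite mevC // der_ratr big1 // => i _.
  by rewrite mderivC mev_0 // mul0r.
- rewrite mevX // (bigD1 i) //= mderivX mnm1E eqxx scale1r.
  have -> : (U_(i) - U_(i))%MM = 0%MM by apply/mnmP => j; rewrite mnmBE subnn mnm0E.
  rewrite mpolyX0 mev1 // mul1r big1 ?addr0 // => j ji.
  by rewrite mderivX mnm1E eq_sym (negbTE ji) scale0r mev_0 // mul0r.
- rewrite mevD // derD Hp Hq -big_split; apply: eq_bigr => i _ /=.
  by rewrite mderivD mevD // mulrDl.
- rewrite mevM // derM Hp Hq big_distrl big_distrr -big_split.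
  apply: eq_bigr => i _ /=; rewrite mderivM mevD // !mevM //; ring.
Qed.
End Derivations.

(* The Jacobian criterion, on a relation of minimal degree. *)
Lemma alg_indep_derivations (M : fieldType) (charM : [pchar M] =i pred0)
  t (theta : 'I_t -> M) :
  (forall w : 'I_t -> M,
     (forall D, derivation D -> \sum_i w i * D (theta i) = 0) -> w =1 fun=> 0) ->
  forall p, mev theta p = 0 -> p = 0.
Proof.
move=> jac p; have [n] := ubnP (msize p); elim: n p => // n IH p.
rewrite ltnS => sp p0.
(* The values at [theta] of the partial derivatives form a vector [w] as in the hypothesis, so they
   vanish; each partial derivative is then a relation of smaller degree. *)
have w0 i : p^`M(i) = 0.
  have [// | q0] := eqVneq (p^`M(i)) 0; apply: IH; last first.
    apply: (jac (fun i => mev theta p^`M(i))) => D Dder.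
    by rewrite -(der_mev charM) // p0 (der0 Dder).
  rewrite -(mlead_deg q0); apply: leq_trans sp.
  have := mlead_supp q0; rewrite mcoeff_msupp mcoeff_mderiv => h.
  have : (mlead p^`M(i) + U_(i))%MM \in msupp p.
    by rewrite mcoeff_msupp; apply: contraNneq h => ->; rewrite mul0rn.
  by move=> /msize_mdeg_lt; rewrite mdegD mdeg1 addn1.
(* In characteristic zero, vanishing partial derivatives leave only the constant term. *)
have pc : p = (p@_0)%:MP.
  apply/mpolyP => m; rewrite mcoeffC; have [->|m0] := eqVneq 0%MM m.
    by rewrite mulr1.
  have [i mi] : exists i, (0 < m i)%N.
    apply/existsP; apply: contraT => /existsPn h; case/eqP: m0.
    by apply/mnmP => i; have := h i; rewrite -eqn0Ngt mnm0E => /eqP.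
  have mE : m = (m - U_(i) + U_(i))%MM.
    by apply/mnmP => j; rewrite mnmDE mnmBE mnm1E; case: eqP => [<-|_];
       rewrite ?subnK ?subn0 ?addn0.
  have := congr1 (fun q => q@_(m - U_(i))) (w0 i).
  rewrite mcoeff_mderiv -mE mcoeff0 mulr0 -mulr_natr => /eqP.
  by rewrite mulf_eq0 Num.Theory.pnatr_eq0 orbF => /eqP.
move: p0; rewrite pc mevC // => /eqP; rewrite (fmorph_eq0 (ratr0 charM)) => /eqP ->.
by rewrite mpolyC0.
Qed.

Section VectorFields.
Variables (s : nat) (c : 'I_s -> {mpoly rat[s]}).

Definition vfield (p : {mpoly rat[s]}) := \sum_i c i * p^`M(i).

Lemma vfieldB : zmod_morphism vfield.
Proof.
by move=> p q; rewrite /vfield -sumrB; apply: eq_bigr => i _; rewrite mderivB mulrBr.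
Qed.

Lemma vfieldM p q : vfield (p * q) = vfield p * q + p * vfield q.
Proof.
rewrite /vfield big_distrl big_distrr -big_split; apply: eq_bigr => i _ /=.
by rewrite mderivM; ring.
Qed.

Definition frac_vfield : ratfun s -> ratfun s := frac_der vfield.

Lemma frac_vfield_derivation : derivation frac_vfield.
Proof.
split; first exact: frac_derB vfieldB vfieldM.
exact: frac_derM vfieldM.
Qed.

Lemma frac_vfieldX i : frac_vfield (Xf i) = FracField.tofrac (c i).
Proof.
rewrite /frac_vfield frac_der_tofrac; last exact: vfieldM.
congr FracField.tofrac; rewrite /vfield (bigD1 i) //= mderivX mnm1E eqxx scale1r.
have -> : (U_(i) - U_(i))%MM = 0%MM by apply/mnmP => j; rewrite mnmBE subnn mnm0E.
rewrite mpolyX0 mulr1 big1 ?addr0 // => j ji.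
by rewrite mderivX mnm1E eq_sym (negbTE ji) scale0r mulr0.
Qed.
End VectorFields.

(** * The invariants *)

(* For v = x0 + x1 i + x2 j + x3 k and (e_1, e_2, e_3) = (i, j, k), the e_n
   component r_mn of conj(v) e_m v is obtained from r_11, r_12, r_13 by cyclic
   permutations of (x1, x2, x3). *)
Section Quaternion.
Variable K : fieldType.
Implicit Types x y : K.

Definition q11 x0 x1 x2 x3 : K := x0 ^+ 2 + x1 ^+ 2 - x2 ^+ 2 - x3 ^+ 2.
Definition q12 x0 x1 x2 x3 : K := (x1 * x2 - x0 * x3) *+ 2.
Definition q13 x0 x1 x2 x3 : K := (x1 * x3 + x0 * x2) *+ 2.
Definition qnorm x0 x1 x2 x3 : K := x0 ^+ 2 + x1 ^+ 2 + x2 ^+ 2 + x3 ^+ 2.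
Definition bq x0 x1 x2 x3 : K := q12 x0 x1 x2 x3 / q11 x0 x1 x2 x3.
Definition cq x0 x1 x2 x3 : K := q13 x0 x1 x2 x3 / q11 x0 x1 x2 x3.

(** Up to cyclic order, [fA] determines the shape of the triple (b1, b2, b3), [fW] its scale and
    [fE] its translation. *)
Definition fE b1 b2 b3 : K := b1 + b2 + b3.
(** The sum of the cyclic images of r = (b1 - b2) / (b2 - b3), that is, the parameter of the
    simplest cubic of which they are the roots. *)
Definition fA b1 b2 b3 : K :=
  (b1 - b2) / (b2 - b3) + (b2 - b3) / (b3 - b1) + (b3 - b1) / (b1 - b2).
Definition fD b1 b2 b3 : K :=
  (b1 - b2) * (b2 - b3) + (b2 - b3) * (b3 - b1) + (b3 - b1) * (b1 - b2).
Definition fW b1 b2 b3 : K := (b1 - b2) * (b2 - b3) * (b3 - b1) / fD b1 b2 b3.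
(* The derivative of fA with respect to b1. *)
Definition fA1 b1 b2 b3 : K :=
  (b2 - b3)^-1 + (b2 - b3) / (b3 - b1) ^+ 2 - (b1 - b2)^-1
  - (b3 - b1) / (b1 - b2) ^+ 2.

Definition theta4 x0 x1 x2 x3 (i : 'I_4) : K :=
  let b1 := bq x0 x1 x2 x3 in
  let b2 := bq x0 x2 x3 x1 in
  let b3 := bq x0 x3 x1 x2 in
  nth 0 [:: fE b1 b2 b3; fA b1 b2 b3; fW b1 b2 b3; qnorm x0 x1 x2 x3] i.

Definition theta (l : 'I_4 -> K) : 'I_4 -> K :=
  theta4 (l (inord 0)) (l (inord 1)) (l (inord 2)) (l (inord 3)).

(* The Jacobian determinant of (b1, b2, b3) along right multiplication by
   i, j, k, where (b, c) are the ratios bq and cq. *)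
Definition jac b1 b2 b3 c1 c2 c3 : K :=
  c1 * (c2 * c3 + b2 * c2 * (1 + b3 ^+ 2))
  + (1 + b2 ^+ 2) * (b1 * c1 * c3 - (1 + b1 ^+ 2) * (1 + b3 ^+ 2))
  + b3 * c3 * (b1 * c1 * b2 * c2 + c2 * (1 + b1 ^+ 2)).

Lemma fE_cyc b1 b2 b3 : fE b2 b3 b1 = fE b1 b2 b3.
Proof. by rewrite /fE; ring. Qed.
Lemma fA_cyc b1 b2 b3 : fA b2 b3 b1 = fA b1 b2 b3.
Proof. by rewrite /fA addrC addrA. Qed.
Lemma fD_cyc b1 b2 b3 : fD b2 b3 b1 = fD b1 b2 b3.
Proof. by rewrite /fD; ring. Qed.
Lemma fW_cyc b1 b2 b3 : fW b2 b3 b1 = fW b1 b2 b3.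
Proof. by rewrite /fW fD_cyc; congr (_ / _); ring. Qed.

Lemma qnorm_cyc x0 x1 x2 x3 : qnorm x0 x2 x3 x1 = qnorm x0 x1 x2 x3.
Proof. by rewrite /qnorm; ring. Qed.

Lemma theta4_cyc x0 x1 x2 x3 : theta4 x0 x2 x3 x1 = theta4 x0 x1 x2 x3.
Proof. by rewrite /theta4 fE_cyc fA_cyc fW_cyc qnorm_cyc. Qed.

(** The second transvection also permutes the b_i cyclically; in two of the ratios the numerator and
    the denominator both change sign. *)
Lemma theta4_inv x0 x1 x2 x3 : theta4 x2 x1 (- x3) (- x0) = theta4 x0 x1 x2 x3.
Proof.
have b3 : bq x2 x1 (- x3) (- x0) = bq x0 x3 x1 x2.
  rewrite /bq (_ : q11 _ _ _ _ = - q11 x0 x3 x1 x2); last by rewrite /q11; ring.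
  rewrite (_ : q12 _ _ _ _ = - q12 x0 x3 x1 x2); last by rewrite /q12; ring.
  by rewrite invrN mulrNN.
have b1 : bq x2 (- x3) (- x0) x1 = bq x0 x1 x2 x3.
  rewrite /bq (_ : q11 _ _ _ _ = - q11 x0 x1 x2 x3); last by rewrite /q11; ring.
  rewrite (_ : q12 _ _ _ _ = - q12 x0 x1 x2 x3); last by rewrite /q12; ring.
  by rewrite invrN mulrNN.
have b2 : bq x2 (- x0) x1 (- x3) = bq x0 x2 x3 x1.
  by rewrite /bq /q11 /q12; congr (_ / _); ring.
rewrite /theta4 b1 b2 b3 -fE_cyc -fA_cyc -fW_cyc.
by rewrite (_ : qnorm _ _ _ _ = qnorm x0 x1 x2 x3) //; rewrite /qnorm; ring.
Qed.

(** By [SL2_ind] it suffices to treat the two transvections, which are the cases of [theta4_cyc] and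
    [theta4_inv]. *)
Lemma theta_lin A : \det A = 1 -> forall l, theta (lin l A) =1 theta l.
Proof.
move: A; apply: SL2_ind => [l|l|A B hA hB l] i; last first.
- rewrite -(hB l) -(hA (lin l B)) /theta.
  by rewrite !lin_mulmx.
- rewrite /theta; have [-> -> -> ->] := lin_mx2 l 1 0 1 1.
  transitivity (theta4 (l (inord 2)) (l (inord 1)) (- l (inord 3)) (- l (inord 0)) i);
    by [|rewrite theta4_inv].
- rewrite /theta; have [-> -> -> ->] := lin_mx2 l 1 1 0 1.
  transitivity (theta4 (l (inord 0)) (l (inord 2)) (l (inord 3)) (l (inord 1)) i);
    by [|rewrite theta4_cyc].
Qed.

End Quaternion.

(** * Derivatives of the invariants *)

Section Differentials.
Variable K : fieldType.
Implicit Types (b x : K) (D : K -> K).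

(** The derivative of [fW] with respect to [b1]; cyclic permutation gives the other two. *)
Definition fW1 b1 b2 b3 : K :=
  (((b2 - b3) * (b3 - b1) - (b1 - b2) * (b2 - b3)) * fD b1 b2 b3
    - (b1 - b2) * (b2 - b3) * (b3 - b1) * ((b3 - b1) - (b1 - b2)))
  / fD b1 b2 b3 ^+ 2.

Section Distinct.
Variables b1 b2 b3 : K.
Hypotheses (d1 : b1 - b2 != 0) (d2 : b2 - b3 != 0) (d3 : b3 - b1 != 0).
Hypothesis (q : fD b1 b2 b3 != 0).

Lemma der_fE D : derivation D -> D (fE b1 b2 b3) = D b1 + D b2 + D b3.
Proof. by move=> dD; rewrite /fE !(derD dD). Qed.

Lemma der_fA D : derivation D ->
  D (fA b1 b2 b3) = fA1 b1 b2 b3 * D b1 + fA1 b2 b3 b1 * D b2 + fA1 b3 b1 b2 * D b3.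
Proof.
move=> dD; rewrite /fA !(derD dD) !(der_div dD) // !(derB dD) /fA1; field.
by rewrite d1 d2 d3.
Qed.

Lemma der_fW D : derivation D ->
  D (fW b1 b2 b3) = fW1 b1 b2 b3 * D b1 + fW1 b2 b3 b1 * D b2 + fW1 b3 b1 b2 * D b3.
Proof.
(* All cyclic forms of [fD] are brought to [fD b1 b2 b3], which [q] makes nonzero. *)
move=> dD; rewrite /fW1 -(fD_cyc b3 b1 b2) -(fD_cyc b1 b2 b3) (fD_cyc b1 b2 b3).
rewrite /fW !(der_div dD) // !(derM dD).
have -> : D (fD b1 b2 b3) = (b3 - b1 - (b1 - b2)) * D b1
    + (b1 - b2 - (b2 - b3)) * D b2 + (b2 - b3 - (b3 - b1)) * D b3.
  by rewrite /fD !(derD dD) !(derM dD) !(derB dD); ring.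
by rewrite !(derB dD); field.
Qed.

(** Translation invariance of [fA]. The next three identities express that [fA] is homogeneous of
    degree 0, and that [fW] is translation invariant and homogeneous of degree 1. *)
Lemma sum_fA1 : fA1 b1 b2 b3 + fA1 b2 b3 b1 + fA1 b3 b1 b2 = 0.
Proof. by rewrite /fA1; field; rewrite d1 d2 d3. Qed.
Lemma euler_fA1 : b1 * fA1 b1 b2 b3 + b2 * fA1 b2 b3 b1 + b3 * fA1 b3 b1 b2 = 0.
Proof. by rewrite /fA1; field; rewrite d1 d2 d3. Qed.
Lemma sum_fW1 : fW1 b1 b2 b3 + fW1 b2 b3 b1 + fW1 b3 b1 b2 = 0.
Proof.
rewrite /fW1 -(fD_cyc b3 b1 b2) -(fD_cyc b1 b2 b3) (fD_cyc b1 b2 b3).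
by field.
Qed.
Lemma euler_fW1 :
  b1 * fW1 b1 b2 b3 + b2 * fW1 b2 b3 b1 + b3 * fW1 b3 b1 b2 = fW b1 b2 b3.
Proof.
rewrite /fW1 /fW -(fD_cyc b3 b1 b2) -(fD_cyc b1 b2 b3) (fD_cyc b1 b2 b3).
move: q; rewrite /fD => q'; by field.
Qed.
End Distinct.

(* D acts as right multiplication by k on y0 + y1 i + y2 j + y3 k. *)
Lemma der_right_mul D (y0 y1 y2 y3 : K) : derivation D ->
  D y0 = - y3 -> D y1 = y2 -> D y2 = - y1 -> D y3 = y0 ->
  q11 y0 y1 y2 y3 != 0 -> q11 y0 y2 y3 y1 != 0 -> q11 y0 y3 y1 y2 != 0 ->
  [/\ D (bq y0 y1 y2 y3) = (- (1 + bq y0 y1 y2 y3 ^+ 2)) *+ 2,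
      D (bq y0 y2 y3 y1) = (bq y0 y2 y3 y1 * cq y0 y2 y3 y1) *+ 2,
      D (bq y0 y3 y1 y2) = (cq y0 y3 y1 y2) *+ 2 &
      D (qnorm y0 y1 y2 y3) = 0].
Proof.
move=> dD D0 D1 D2 D3 h1 h2 h3; rewrite /bq /cq !(der_div dD) //.
move: h1 h2 h3; rewrite /q11 /q12 /q13 /qnorm => h1 h2 h3.
rewrite !(derMn dD, derB dD, derD dD) !(derX2 dD) !(derM dD) D0 D1 D2 D3.
by split; [field|field|field|ring].
Qed.

(** Cramer's rule: the equations are combined with the cofactors of the first column of the system,
    whose determinant is [jac]. *)
Lemma cramer_jac b1 b2 b3 (c1 c2 c3 t1 t2 t3 : K) : jac b1 b2 b3 c1 c2 c3 != 0 ->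
  t1 * c1 - t2 * (1 + b2 ^+ 2) + t3 * (b3 * c3) = 0 ->
  t1 * (b1 * c1) + t2 * c2 - t3 * (1 + b3 ^+ 2) = 0 ->
  - (t1 * (1 + b1 ^+ 2)) + t2 * (b2 * c2) + t3 * c3 = 0 -> t1 = 0.
Proof.
move=> j0 e1 e2 e3; apply: (mulfI j0); rewrite mulr0.
transitivity ((c2 * c3 + (1 + b3 ^+ 2) * (b2 * c2)) *
    (t1 * c1 - t2 * (1 + b2 ^+ 2) + t3 * (b3 * c3))
  + ((1 + b2 ^+ 2) * c3 + b2 * c2 * b3 * c3) *
    (t1 * (b1 * c1) + t2 * c2 - t3 * (1 + b3 ^+ 2))
  + ((1 + b2 ^+ 2) * (1 + b3 ^+ 2) - b3 * c3 * c2) *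
    (- (t1 * (1 + b1 ^+ 2)) + t2 * (b2 * c2) + t3 * c3)).
  by rewrite /jac; ring.
by rewrite e1 e2 e3 !mulr0 !addr0.
Qed.
End Differentials.

(** * Nonvanishing checked at a rational point *)

Local Notation x0 := (X (inord 0)).
Local Notation x1 := (X (inord 1)).
Local Notation x2 := (X (inord 2)).
Local Notation x3 := (X (inord 3)).
Local Notation b1 := (bq x0 x1 x2 x3).
Local Notation b2 := (bq x0 x2 x3 x1).
Local Notation b3 := (bq x0 x3 x1 x2).
Local Notation c1 := (cq x0 x1 x2 x3).
Local Notation c2 := (cq x0 x2 x3 x1).
Local Notation c3 := (cq x0 x3 x1 x2).

(* All the elements of M that must not vanish are evaluated at this point. *)
Definition pt : 'I_4 -> rat := nth 0 [:: 2; 1; 0; 1].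

Lemma pchar0_rat : [pchar rat] =i pred0.
Proof. exact: Num.Theory.pchar_num. Qed.

Lemma spec_pt :
  [/\ spec_coef pt x0 2, spec_coef pt x1 1, spec_coef pt x2 0 & spec_coef pt x3 1].
Proof.
have h i : spec_coef pt (X i) (pt i) by apply: (spec_coefX pchar0_rat).
split; [have := h (inord 0)|have := h (inord 1)|have := h (inord 2)|have := h (inord 3)];
  by rewrite {2}/pt inordK.
Qed.

(** Follows the structure of the expression, so that unification finds the specialised value; only
    the nonvanishing of the inverted values is left. *)
Ltac spec_rat := first [eassumption
  | apply: (spec_coefD pchar0_rat); spec_rat
  | apply: (spec_coefN pchar0_rat); spec_rat
  | refine (spec_coefV _ _); last spec_rat
  | apply: (spec_coefM pchar0_rat); spec_rat
  | exact: (spec_coef1 pchar0_rat)].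

Section NonZero.
Variables (y0 y1 y2 y3 : M) (k0 k1 k2 k3 : rat).
Hypotheses (h0 : spec_coef pt y0 k0) (h1 : spec_coef pt y1 k1).
Hypotheses (h2 : spec_coef pt y2 k2) (h3 : spec_coef pt y3 k3).

Lemma spec_q11 : spec_coef pt (q11 y0 y1 y2 y3) (q11 k0 k1 k2 k3).
Proof. by rewrite /q11 !expr2; spec_rat. Qed.

Lemma spec_bq : q11 k0 k1 k2 k3 != 0 ->
  spec_coef pt (bq y0 y1 y2 y3) (bq k0 k1 k2 k3).
Proof.
move=> q; apply: (spec_coef_div pchar0_rat q) spec_q11.
by rewrite /q12 !mulr2n; spec_rat.
Qed.

Lemma spec_cq : q11 k0 k1 k2 k3 != 0 ->
  spec_coef pt (cq y0 y1 y2 y3) (cq k0 k1 k2 k3).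
Proof.
move=> q; apply: (spec_coef_div pchar0_rat q) spec_q11.
by rewrite /q13 !mulr2n; spec_rat.
Qed.
End NonZero.

Lemma q11_neq0 :
  [/\ q11 x0 x1 x2 x3 != 0, q11 x0 x2 x3 x1 != 0 & q11 x0 x3 x1 x2 != 0].
Proof.
have [h0 h1 h2 h3] := spec_pt.
by split; apply: (spec_coef_neq0 pchar0_rat (spec_q11 _ _ _ _)); eauto.
Qed.

Lemma spec_b : [/\ spec_coef pt b1 (-1), spec_coef pt b2 (-2) & spec_coef pt b3 2^-1].
Proof.
have [h0 h1 h2 h3] := spec_pt; split.
- by apply: (eq_rect _ (spec_coef pt b1) (spec_bq h0 h1 h2 h3 _)); vm_compute.
- by apply: (eq_rect _ (spec_coef pt b2) (spec_bq h0 h2 h3 h1 _)); vm_compute.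
- by apply: (eq_rect _ (spec_coef pt b3) (spec_bq h0 h3 h1 h2 _)); vm_compute.
Qed.

Lemma spec_c : [/\ spec_coef pt c1 2^-1, spec_coef pt c2 2 & spec_coef pt c3 1].
Proof.
have [h0 h1 h2 h3] := spec_pt; split.
- by apply: (eq_rect _ (spec_coef pt c1) (spec_cq h0 h1 h2 h3 _)); vm_compute.
- by apply: (eq_rect _ (spec_coef pt c2) (spec_cq h0 h2 h3 h1 _)); vm_compute.
- by apply: (eq_rect _ (spec_coef pt c3) (spec_cq h0 h3 h1 h2 _)); vm_compute.
Qed.

Lemma bq_distinct : [/\ b1 - b2 != 0, b2 - b3 != 0 & b3 - b1 != 0].
Proof.
have [h1 h2 h3] := spec_b.
split; [apply: (spec_coef_neq0 pchar0_rat (spec_coefB pchar0_rat h1 h2))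
       |apply: (spec_coef_neq0 pchar0_rat (spec_coefB pchar0_rat h2 h3))
       |apply: (spec_coef_neq0 pchar0_rat (spec_coefB pchar0_rat h3 h1))];
  by vm_compute.
Qed.

Lemma fD_neq0 : fD b1 b2 b3 != 0.
Proof.
have [h1 h2 h3] := spec_b; rewrite /fD.
apply: (spec_coef_neq0 (x := pt) pchar0_rat); first by (spec_rat; vm_compute).
by vm_compute.
Qed.

Lemma fA1_neq0 : fA1 b1 b2 b3 != 0.
Proof.
have [h1 h2 h3] := spec_b; rewrite /fA1 !expr2.
apply: (spec_coef_neq0 (x := pt) pchar0_rat); first by (spec_rat; vm_compute).
by vm_compute.
Qed.

Lemma jac_neq0 : jac b1 b2 b3 c1 c2 c3 != 0.
Proof.
have [h1 h2 h3] := spec_b; have [g1 g2 g3] := spec_c; rewrite /jac !expr2.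
apply: (spec_coef_neq0 (x := pt) pchar0_rat); first by (spec_rat; vm_compute).
by vm_compute.
Qed.

(** This is the denominator when [cq_bq] expresses the c_i through the b_i. *)
Lemma bq_prod_neq0 : 1 + b1 * b2 * b3 != 0.
Proof.
have [h1 h2 h3] := spec_b.
apply: (spec_coef_neq0 (x := pt) pchar0_rat); first by (spec_rat; vm_compute).
by vm_compute.
Qed.

Lemma qnorm_neq0 : qnorm x0 x1 x2 x3 != 0.
Proof.
have [h0 h1 h2 h3] := spec_pt.
rewrite /qnorm !expr2; apply: (spec_coef_neq0 (x := pt) pchar0_rat).
  by spec_rat.
by vm_compute.
Qed.

Lemma fmorph_theta (K L : fieldType) (f : {rmorphism K -> L}) (l : 'I_4 -> K) i :
  f (theta l i) = theta (f \o l) i.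
Proof.
rewrite /theta /theta4 /=.
have fq a b c d : f (bq a b c d) = bq (f a) (f b) (f c) (f d).
  by rewrite /bq fmorph_div /q12 /q11 rmorphMn !rmorphB rmorphD !rmorphXn !rmorphM.
rewrite -!fq; move: (bq _ _ _ _) (bq _ _ _ _) (bq _ _ _ _) => u3 u2 u1.
have -> : fE (f u1) (f u2) (f u3) = f (fE u1 u2 u3) by rewrite /fE !rmorphD.
have -> : fA (f u1) (f u2) (f u3) = f (fA u1 u2 u3).
  by rewrite /fA !(rmorphD, fmorph_div, rmorphN).
have -> : fW (f u1) (f u2) (f u3) = f (fW u1 u2 u3).
  by rewrite /fW fmorph_div /fD !(rmorphD, rmorphM, rmorphN).
have -> : qnorm (f (l (inord 0))) (f (l (inord 1))) (f (l (inord 2))) (f (l (inord 3)))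
   = f (qnorm (l (inord 0)) (l (inord 1)) (l (inord 2)) (l (inord 3))).
  by rewrite /qnorm !rmorphD !rmorphXn.
by case: i => [[|[|[|[|i]]]]].
Qed.

Lemma eq_theta (K : fieldType) (l l' : 'I_4 -> K) : l =1 l' -> theta l =1 theta l'.
Proof. by move=> e i; rewrite /theta !e. Qed.

(** [bq] is homogeneous of degree 0, whereas [qnorm] has degree 2. *)
Lemma der_bq_euler (K : fieldType) (D : K -> K) y0 y1 y2 y3 : derivation D ->
  q11 y0 y1 y2 y3 != 0 -> D y0 = y0 -> D y1 = y1 -> D y2 = y2 -> D y3 = y3 ->
  D (bq y0 y1 y2 y3) = 0.
Proof.
move=> dD h D0 D1 D2 D3; rewrite /bq (der_div dD) //.
move: h; rewrite /q11 /q12 => h.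
rewrite !(derMn dD, derB dD, derD dD) !(derX2 dD) !(derM dD) D0 D1 D2 D3.
by field.
Qed.

Lemma der_qnorm_euler (K : fieldType) (D : K -> K) y0 y1 y2 y3 : derivation D ->
  D y0 = y0 -> D y1 = y1 -> D y2 = y2 -> D y3 = y3 ->
  D (qnorm y0 y1 y2 y3) = qnorm y0 y1 y2 y3 *+ 2.
Proof.
move=> dD D0 D1 D2 D3; rewrite /qnorm !(derD dD) !(derX2 dD) D0 D1 D2 D3; ring.
Qed.

Section Jacobian.
Variables (K : fieldType) (x0 x1 x2 x3 : K).
Local Notation b1 := (bq x0 x1 x2 x3).
Local Notation b2 := (bq x0 x2 x3 x1).
Local Notation b3 := (bq x0 x3 x1 x2).
Local Notation c1 := (cq x0 x1 x2 x3).
Local Notation c2 := (cq x0 x2 x3 x1).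
Local Notation c3 := (cq x0 x3 x1 x2).
Hypothesis nat0 : forall n, (n%:R == 0 :> K) = (n == 0).
Hypotheses (q1 : q11 x0 x1 x2 x3 != 0) (q2 : q11 x0 x2 x3 x1 != 0).
Hypotheses (q3 : q11 x0 x3 x1 x2 != 0).
Hypotheses (d1 : b1 - b2 != 0) (d2 : b2 - b3 != 0) (d3 : b3 - b1 != 0).
Hypotheses (q : fD b1 b2 b3 != 0) (a10 : fA1 b1 b2 b3 != 0).
Hypotheses (j1 : jac b1 b2 b3 c1 c2 c3 != 0) (norm0 : qnorm x0 x1 x2 x3 != 0).
(* D 0 is the Euler field, D 1, D 2, D 3 are right multiplication by i, j, k. *)
Variable D : nat -> K -> K.
Hypothesis dD : forall n, derivation (D n).
Hypothesis Dx : forall n, [/\ D n x0 = nth 0 [:: x0; - x1; - x2; - x3] n,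
  D n x1 = nth 0 [:: x1; x0; - x3; x2] n, D n x2 = nth 0 [:: x2; x3; x0; - x1] n &
  D n x3 = nth 0 [:: x3; - x2; x1; x0] n].

(** With t_i the coefficient of D b_i in the relation, the Euler field isolates [w3] and the three
    right multiplications give a linear system of determinant [jac] for the t_i. Translation and
    homogeneity then separate [w0], [w2] and [w1]. *)
Lemma theta_jacobian (w0 w1 w2 w3 : K) :
  (forall n, w0 * D n (fE b1 b2 b3) + w1 * D n (fA b1 b2 b3) + w2 * D n (fW b1 b2 b3)
    + w3 * D n (qnorm x0 x1 x2 x3) = 0) -> [/\ w0 = 0, w1 = 0, w2 = 0 & w3 = 0].
Proof.
move=> hE.
pose t1 := w0 + w1 * fA1 b1 b2 b3 + w2 * fW1 b1 b2 b3.
pose t2 := w0 + w1 * fA1 b2 b3 b1 + w2 * fW1 b2 b3 b1.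
pose t3 := w0 + w1 * fA1 b3 b1 b2 + w2 * fW1 b3 b1 b2.
have hT n : t1 * D n b1 + t2 * D n b2 + t3 * D n b3 + w3 * D n (qnorm x0 x1 x2 x3) = 0.
  rewrite -(hE n) der_fE ?der_fA ?der_fW // /t1 /t2 /t3; ring.
have char2 (m : K) : m *+ 2 = 0 -> m = 0.
  move/eqP; rewrite -mulr_natr mulf_eq0 (nat0 _) orbF; exact: eqP.
have [Dx00 Dx01 Dx02 Dx03] := Dx 0; have [Dx10 Dx11 Dx12 Dx13] := Dx 1.
have [Dx20 Dx21 Dx22 Dx23] := Dx 2; have [Dx30 Dx31 Dx32 Dx33] := Dx 3.
(* Right multiplication by i or j becomes right multiplication by k after a cyclic permutation of
   (x1, x2, x3). *)
have [e11 e12 e13 e14] := der_right_mul (dD 1) Dx10 Dx12 Dx13 Dx11 q2 q3 q1.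
have [e21 e22 e23 e24] := der_right_mul (dD 2) Dx20 Dx23 Dx21 Dx22 q3 q1 q2.
have [e31 e32 e33 e34] := der_right_mul (dD 3) Dx30 Dx31 Dx32 Dx33 q1 q2 q3.
have w30 : w3 = 0.
  have := hT 0; rewrite !(der_bq_euler (dD 0)) // (der_qnorm_euler (dD 0)) //.
  rewrite !mulr0 !add0r mulrnAr => /char2/eqP.
  by rewrite mulf_eq0 (negbTE norm0) orbF => /eqP.
have E1 : t1 * c1 - t2 * (1 + b2 ^+ 2) + t3 * (b3 * c3) = 0.
  by apply: char2; rewrite -(hT 1) e13 e11 e12 w30 mul0r addr0; ring.
have E2 : t1 * (b1 * c1) + t2 * c2 - t3 * (1 + b3 ^+ 2) = 0.
  by apply: char2; rewrite -(hT 2) e21 e22 e23 w30 mul0r addr0; ring.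
have E3 : - (t1 * (1 + b1 ^+ 2)) + t2 * (b2 * c2) + t3 * c3 = 0.
  by apply: char2; rewrite -(hT 3) e31 e32 e33 w30 mul0r addr0; ring.
have j2 : jac b2 b3 b1 c2 c3 c1 != 0.
  by rewrite (_ : jac _ _ _ _ _ _ = jac b1 b2 b3 c1 c2 c3) // /jac; ring.
have j3 : jac b3 b1 b2 c3 c1 c2 != 0.
  by rewrite (_ : jac _ _ _ _ _ _ = jac b1 b2 b3 c1 c2 c3) // /jac; ring.
have t10 : t1 = 0 := cramer_jac j1 E1 E2 E3.
have t20 : t2 = 0.
  apply: (cramer_jac j2 (t1 := t2) (t2 := t3) (t3 := t1)).
  - by rewrite -E2; ring.
  - by rewrite -E3; ring.
  - by rewrite -E1; ring.
have t30 : t3 = 0.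
  apply: (cramer_jac j3 (t1 := t3) (t2 := t1) (t3 := t2)).
  - by rewrite -E3; ring.
  - by rewrite -E1; ring.
  - by rewrite -E2; ring.
have w00 : w0 = 0.
  have : t1 + t2 + t3 = w0 *+ 3.
    rewrite -[RHS]addr0 -(mulr0 w1) -(sum_fA1 d1 d2 d3) -[RHS]addr0.
    by rewrite -(mulr0 w2) -(sum_fW1 q) /t1 /t2 /t3; ring.
  rewrite t10 t20 t30 !addr0 => /esym/eqP.
  by rewrite -mulr_natr mulf_eq0 (nat0 _) orbF => /eqP.
(* Euler's relations remove [fA] and leave [fW], which is nonzero as the b_i are distinct. *)
have w20 : w2 = 0.
  have : b1 * t1 + b2 * t2 + b3 * t3 = w2 * fW b1 b2 b3.
    rewrite -[RHS]addr0 -(mulr0 w1) -(euler_fA1 d1 d2 d3) -(euler_fW1 q).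
    by rewrite /t1 /t2 /t3 w00; ring.
  rewrite t10 t20 t30 !mulr0 !addr0 => /esym/eqP.
  rewrite mulf_eq0 => /orP [/eqP //|]; rewrite /fW.
  by rewrite !mulf_eq0 invr_eq0 (negbTE q) (negbTE d1) (negbTE d2) (negbTE d3).
have w10 : w1 = 0.
  move/eqP: t10; rewrite /t1 w00 w20 mul0r add0r addr0 mulf_eq0 (negbTE a10).
  by rewrite orbF => /eqP.
by split.
Qed.
End Jacobian.

Definition dir (n : nat) : 'I_4 -> {mpoly rat[4]} := fun i =>
  let y j : {mpoly rat[4]} := 'X_(inord j) in
  nth 0 (nth [::] [:: [:: y 0; y 1; y 2; y 3]%N;
    [:: - y 1; y 0; y 3; - y 2]%N; [:: - y 2; - y 3; y 0; y 1]%N;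
    [:: - y 3; y 2; - y 1; y 0]%N] n) i.

Local Notation D n := (frac_vfield (dir n)).

Lemma theta_alg_indep p : mev (theta X) p = 0 -> p = 0.
Proof.
move: p; apply: (alg_indep_derivations cM) => w h.
have DX n i : D n (X i) = FracField.tofrac (dir n i) by apply: frac_vfieldX.
have dD n : derivation (D n) by apply: frac_vfield_derivation.
have Dx n : [/\ D n x0 = nth 0 [:: x0; - x1; - x2; - x3] n,
  D n x1 = nth 0 [:: x1; x0; - x3; x2] n, D n x2 = nth 0 [:: x2; x3; x0; - x1] n &
  D n x3 = nth 0 [:: x3; - x2; x1; x0] n].
  (* For n > 3 both sides are the default value 0. *)
  rewrite !DX /dir /Xf !inordK //=; case: n => [|[|[|[|n]]]];
  by rewrite /= ?nth_nil ?tofracN ?tofrac0.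
have [q1 q2 q3] := q11_neq0; have [d1 d2 d3] := bq_distinct; have q := fD_neq0.
have norm0 := qnorm_neq0.
pose w0 := w ord0; pose w1 := w (lift ord0 ord0).
pose w2 := w (lift ord0 (lift ord0 ord0)).
pose w3 := w (lift ord0 (lift ord0 (lift ord0 ord0))).
have hE n : w0 * D n (fE b1 b2 b3) + w1 * D n (fA b1 b2 b3) + w2 * D n (fW b1 b2 b3)
    + w3 * D n (qnorm x0 x1 x2 x3) = 0.
  have := h _ (dD n); rewrite !big_ord_recl big_ord0 addr0 -!addrA.
  by rewrite /theta /theta4 /=.
have [w00 w10 w20 w30] := theta_jacobian ((pcharf0P _).1 cM) q1 q2 q3 d1 d2 d3 q
  fA1_neq0 jac_neq0 norm0 dD Dx hE.
move=> i; case: (unliftP ord0 i) => [{}i|] -> //.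
case: (unliftP ord0 i) => [{}i|] -> //; case: (unliftP ord0 i) => [{}i|] -> //.
by rewrite (ord1 i).
Qed.

(** * Quadratic and cubic steps *)

Section Subfields.
Variable K : fieldType.
Implicit Types (S B : K -> Prop) (u v m : K).

(** Subfields are [Prop]-valued predicates, since the main example is the image of a morphism, given
    by an existential. *)
Definition subfld S := [/\ S 1, forall u v, S u -> S v -> S (u - v),
  forall u v, S u -> S v -> S (u * v) & forall u, S u -> S u^-1].

Section Closure.
Variables (S : K -> Prop) (hS : subfld S).

Lemma subfld1 : S 1. Proof. by case: hS. Qed.
Lemma subfldB u v : S u -> S v -> S (u - v). Proof. by case: hS => _ h _ _; apply: h. Qed.
Lemma subfldM u v : S u -> S v -> S (u * v). Proof. by case: hS => _ _ h _; apply: h. Qed.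
Lemma subfldV u : S u -> S u^-1. Proof. by case: hS => _ _ _ h; apply: h. Qed.
Lemma subfld0 : S 0. Proof. by rewrite -(subrr 1); apply: subfldB; apply: subfld1. Qed.
Lemma subfldN u : S u -> S (- u).
Proof. by move=> Su; rewrite -sub0r; apply: subfldB => //; apply: subfld0. Qed.
Lemma subfldD u v : S u -> S v -> S (u + v).
Proof. by move=> Su Sv; rewrite -[v]opprK; apply: subfldB => //; apply: subfldN. Qed.
Lemma subfldX u n : S u -> S (u ^+ n).
Proof.
move=> Su; elim: n => [|n IH]; first by rewrite expr0; apply: subfld1.
by rewrite exprS; apply: subfldM.
Qed.
Lemma subfld_nat n : S n%:R.
Proof.
elim: n => [|n IH]; first exact: subfld0.
by rewrite -natr1; apply: subfldD => //; apply: subfld1.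
Qed.
Lemma subfld_div u v : S u -> S v -> S (u / v).
Proof. by move=> Su Sv; apply: subfldM => //; apply: subfldV. Qed.
End Closure.
End Subfields.

Ltac subfld h := repeat first [eassumption | exact: (subfld1 h) | exact: (subfld0 h)
  | exact: (subfld_nat h) | apply: (subfldX h) | apply: (subfldN h)
  | apply: (subfldV h) | apply: (subfldM h) | apply: (subfldD h)].

Section Quadratic.
Variable K : fieldType.
Implicit Types u v m : K.
Variables (B : K -> Prop) (hB : subfld B) (s : {rmorphism K -> K}) (y : K).
Hypotheses (sB : forall u, B u -> s u = u) (y2 : B (y ^+ 2)) (sy : s y = - y).
Hypotheses (char2 : 2 != 0 :> K) (y0 : y != 0).

Definition qext m := exists u v, [/\ B u, B v & m = u + v * y].

Lemma qext_sub u : B u -> qext u.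
Proof. by move=> Bu; exists u, 0; rewrite mul0r addr0; split=> //; apply: subfld0. Qed.

Lemma qext_gen : qext y.
Proof.
by exists 0, 1; rewrite mul1r add0r; split=> //; [apply: subfld0 | apply: subfld1].
Qed.

Lemma qext_fixed m : qext m -> s m = m -> B m.
Proof.
case=> u [v [Bu Bv ->]] /eqP; rewrite rmorphD rmorphM /= (sB Bu) (sB Bv) sy.
rewrite (inj_eq (addrI u)) mulrN eq_sym -subr_eq0 opprK -mulr2n -mulr_natl.
rewrite !mulf_eq0 (negbTE char2) (negbTE y0) orbF => /eqP ->.
by rewrite mul0r addr0.
Qed.

(** Inverses come from the norm: m^-1 = s m / (m * s m), with m * s m in [B]. *)
Lemma subfld_qext : subfld qext.
Proof.
have qM m m' : qext m -> qext m' -> qext (m * m').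
  case=> u [v [Bu Bv ->]] [u' [v' [Bu' Bv' ->]]].
  exists (u * u' + v * v' * y ^+ 2), (u * v' + v * u'); split; last by ring.
    by subfld hB.
  by subfld hB.
split; [exact/qext_sub/(subfld1 hB)| |exact: qM|].
  move=> m m' [u [v [Bu Bv ->]]] [u' [v' [Bu' Bv' ->]]].
  by exists (u - u'), (v - v'); split; [exact: (subfldB hB)|exact: (subfldB hB)|ring].
move=> m qm; have [->|m0] := eqVneq m 0.
  by rewrite invr0; apply/qext_sub/(subfld0 hB).
have sm0 : s m != 0 by rewrite fmorph_eq0.
have -> : m^-1 = s m * (m * s m)^-1 by field; rewrite sm0 m0.
have qsm : qext (s m).
  case: qm => u [v [Bu Bv ->]]; exists u, (- v); split=> //.
    exact: (subfldN hB).
  by rewrite rmorphD rmorphM /= (sB Bu) (sB Bv) sy mulrN mulNr.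
apply: qM => //; apply/qext_sub/(subfldV hB).
case: qm => u [v [Bu Bv ->]]; rewrite rmorphD rmorphM /= (sB Bu) (sB Bv) sy.
rewrite (_ : _ * _ = u * u - v * v * y ^+ 2); last by ring.
by subfld hB.
Qed.
End Quadratic.

(* The simplest cubic X^3 - a X^2 - (a + 3) X - 1 of Shanks: its roots are
   permuted cyclically by r |-> r^2 - (a + 1) r - 2 = - 1 / (1 + r). *)
Section Cubic.
Variable K : fieldType.
Implicit Types u v m : K.
Variables (B : K -> Prop) (hB : subfld B) (s : {rmorphism K -> K}) (a r : K).
Hypotheses (sB : forall u, B u -> s u = u) (Ba : B a).
Hypothesis r3 : r ^+ 3 = a * r ^+ 2 + (a + 3) * r + 1.
Hypothesis sr : s r = r ^+ 2 - (a + 1) * r - 2.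
Hypothesis ssr : s (s r) = a - r - s r.
Hypothesis char3 : 3 != 0 :> K.

Definition cext m := exists u v w, [/\ B u, B v, B w & m = u + v * r + w * r ^+ 2].

Let Bn n : B n%:R. Proof. exact: subfld_nat. Qed.
Let B1 : B 1. Proof. exact: subfld1. Qed.

Lemma cext_sub u : B u -> cext u.
Proof.
by move=> Bu; exists u, 0, 0; rewrite !mul0r !addr0; split=> //; apply: subfld0.
Qed.

Lemma cext_gen : cext r.
Proof.
exists 0, 1, 0; rewrite mul1r mul0r add0r addr0.
by split=> //; apply: subfld0.
Qed.

Let cD m m' : cext m -> cext m' -> cext (m + m').
Proof.
case=> u [v [w [Bu Bv Bw ->]]] [u' [v' [w' [Bu' Bv' Bw' ->]]]].
by exists (u + u'), (v + v'), (w + w'); split; try exact: (subfldD hB); ring.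
Qed.

Let cZ u m : B u -> cext m -> cext (u * m).
Proof.
move=> Bu [u' [v' [w' [Bu' Bv' Bw' ->]]]].
by exists (u * u'), (u * v'), (u * w'); split; try exact: (subfldM hB); ring.
Qed.

Let cr m : cext m -> cext (r * m).
Proof.
case=> u [v [w [Bu Bv Bw ->]]].
exists w, (u + w * (a + 3)), (v + w * a); split=> //.
- by subfld hB.
- by subfld hB.
transitivity (u * r + v * r ^+ 2 + w * r ^+ 3); first by ring.
by rewrite r3; ring.
Qed.

Let cM m m' : cext m -> cext m' -> cext (m * m').
Proof.
case=> u [v [w [Bu Bv Bw ->]]] cm'.
rewrite (_ : _ * m' = u * m' + (v * (r * m') + w * (r * (r * m')))); last by ring.
by apply: (cD); [apply: (cZ)|apply: (cD); apply: (cZ) => //; do ? apply: (cr)].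
Qed.

Let sE u v w x : B u -> B v -> B w ->
  s (u + v * x + w * x ^+ 2) = u + v * s x + w * s x ^+ 2.
Proof.
move=> Bu Bv Bw; rewrite !rmorphD !rmorphM /= (sB Bu) (sB Bv) (sB Bw); ring.
Qed.

Let cs m : cext m -> cext (s m).
Proof.
case=> u [v [w [Bu Bv Bw ->]]]; rewrite sE //.
have csr : cext (s r).
  exists (- 2), (- (a + 1)), 1; split=> //.
  - exact: (subfldN hB).
  - by apply: (subfldN hB); apply: (subfldD hB).
  - by rewrite sr; ring.
apply: (cD); last by apply: (cZ) => //; rewrite expr2; apply: (cM).
by apply: (cD); [apply: cext_sub | apply: (cZ)].
Qed.

(** A fixed element is a third of its trace, and the trace lies in [B] because the power sums of the
    roots are a and a^2 + 2 a + 6. *)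
Lemma cext_fixed m : cext m -> s m = m -> B m.
Proof.
case=> u [v [w [Bu Bv Bw mE]]] sm.
have ssm : s (s m) = m by rewrite !sm.
have -> : m = (m + s m + s (s m)) / 3 by rewrite ssm sm; field.
rewrite mE !sE // ssr.
rewrite (_ : _ + _ = 3 * u + v * a + w * (a ^+ 2 + 2 * a + 6)).
  by subfld hB.
have sq : r ^+ 2 + (s r) ^+ 2 + (a - r - s r) ^+ 2 = a ^+ 2 + 2 * a + 6.
  apply/eqP; rewrite -subr_eq0 sr.
  rewrite (_ : _ - _ = (r ^+ 3 - (a * r ^+ 2 + (a + 3) * r + 1)) * (2 * r - 2 * a - 2)).
    by rewrite r3 subrr mul0r.
  by ring.
by rewrite -sq; ring.
Qed.

(** Inverses again come from the norm m * s m * s (s m): it is fixed since [s] cubed is the identity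
    on [cext], so it lies in [B]. *)
Lemma subfld_cext : subfld cext.
Proof.
split; [exact/cext_sub| |exact: (cM)|].
  move=> m m' cm cm'; apply: (cD) => //.
  by rewrite -mulN1r; apply: (cZ) => //; apply: (subfldN hB).
move=> m cm; have [->|m0] := eqVneq m 0.
  by rewrite invr0; apply/cext_sub/(subfld0 hB).
have [sm0 ssm0] : s m != 0 /\ s (s m) != 0 by rewrite !fmorph_eq0.
have -> : m^-1 = s m * s (s m) * (m * s m * s (s m))^-1.
  by field; rewrite m0 sm0 ssm0.
apply: (cM); first by apply: (cM); do ! apply: (cs).
apply/cext_sub/(subfldV hB)/cext_fixed.
  by apply: (cM); [apply: (cM)|]; do ? apply: (cs).
have sssm : s (s (s m)) = m.
  have sssr : s (s (s r)) = r by rewrite ssr !rmorphB /= ssr (sB Ba); ring.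
  case: (cm) => u [v [w [Bu Bv Bw ->]]].
  by rewrite !sE // sssr.
by rewrite !rmorphM /= sssm; ring.
Qed.
End Cubic.

(** * The fixed field *)

Section Identities.
Variable K : fieldType.
Implicit Types b x : K.

Definition rho b1 b2 b3 : K := (b1 - b2) / (b2 - b3).

Section Rho.
Variables b1 b2 b3 : K.
Hypotheses (d1 : b1 - b2 != 0) (d2 : b2 - b3 != 0) (d3 : b3 - b1 != 0).
Local Notation r := (rho b1 b2 b3).
Local Notation a := (fA b1 b2 b3).

Lemma rho_cubic : r ^+ 3 = a * r ^+ 2 + (a + 3) * r + 1.
Proof. by rewrite /rho /fA; field; rewrite d1 d2 d3. Qed.

Lemma rho_next : rho b2 b3 b1 = r ^+ 2 - (a + 1) * r - 2.
Proof. by rewrite /rho /fA; field; rewrite d1 d2 d3. Qed.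

Lemma rho_third : rho b3 b1 b2 = a - r - rho b2 b3 b1.
Proof. by rewrite /rho /fA; ring. Qed.

(** With d = b2 - b3, the other differences are r d and - (1 + r) d, so [fW] equals d r (1 + r) / (1
    + r + r^2). *)
Lemma diff_rho : fD b1 b2 b3 != 0 ->
  b2 - b3 = fW b1 b2 b3 * (1 + r + r ^+ 2) / (r * (1 + r)).
Proof.
move=> q; have r0 : r * (1 + r) != 0.
  rewrite mulf_neq0 //; first by rewrite mulf_neq0 ?invr_eq0.
  rewrite (_ : 1 + r = - (b3 - b1) / (b2 - b3)); last by rewrite /rho; field.
  by rewrite mulf_neq0 ?oppr_eq0 ?invr_eq0.
apply: (canRL (mulfK r0)); move: q; rewrite /fW /rho /fD => q.
by field; rewrite q d2.
Qed.
End Rho.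

(** Orthogonality of the first two rows of (r_mn), divided by r11 r22. *)
Lemma bq_orthogonal x0 x1 x2 x3 : q11 x0 x1 x2 x3 != 0 -> q11 x0 x2 x3 x1 != 0 ->
  bq x0 x1 x2 x3 + cq x0 x2 x3 x1 + cq x0 x1 x2 x3 * bq x0 x2 x3 x1 = 0.
Proof.
move=> h1 h2.
transitivity ((q12 x0 x1 x2 x3 * q11 x0 x2 x3 x1 + q13 x0 x2 x3 x1 * q11 x0 x1 x2 x3
  + q13 x0 x1 x2 x3 * q12 x0 x2 x3 x1) / (q11 x0 x1 x2 x3 * q11 x0 x2 x3 x1)).
  by rewrite /bq /cq; field; rewrite h1 h2.
by rewrite (_ : _ + _ = 0) ?mul0r // /q11 /q12 /q13; ring.
Qed.

(** Each row of (r_mn) has length N. *)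
Lemma q11_sq x0 x1 x2 x3 : q11 x0 x1 x2 x3 != 0 ->
  q11 x0 x1 x2 x3 ^+ 2 * (1 + bq x0 x1 x2 x3 ^+ 2 + cq x0 x1 x2 x3 ^+ 2) =
  qnorm x0 x1 x2 x3 ^+ 2.
Proof.
move=> h; transitivity (q11 x0 x1 x2 x3 ^+ 2 + q12 x0 x1 x2 x3 ^+ 2 + q13 x0 x1 x2 x3 ^+ 2).
  by rewrite /bq /cq; field.
by rewrite /q11 /q12 /q13 /qnorm; ring.
Qed.

(** For N times a rotation, the minor r11 r22 - r12 r21 is N r33. *)
Lemma q11_det x0 x1 x2 x3 : q11 x0 x1 x2 x3 != 0 -> q11 x0 x2 x3 x1 != 0 ->
  q11 x0 x1 x2 x3 * q11 x0 x2 x3 x1 * (1 - bq x0 x1 x2 x3 * cq x0 x2 x3 x1) =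
  q11 x0 x3 x1 x2 * qnorm x0 x1 x2 x3.
Proof.
rewrite /bq /cq => h1 h2.
transitivity (q11 x0 x1 x2 x3 * q11 x0 x2 x3 x1 - q12 x0 x1 x2 x3 * q13 x0 x2 x3 x1).
  by field; rewrite h1 h2.
by rewrite /q11 /q12 /q13 /qnorm; ring.
Qed.

(** The orthogonality relations are linear in the c_i; [c2] and [c3] are eliminated. *)
Lemma cq_bq b1 b2 b3 (c1 c2 c3 : K) :
  b1 + c2 + c1 * b2 = 0 -> b2 + c3 + c2 * b3 = 0 -> b3 + c1 + c3 * b1 = 0 ->
  c1 * (1 + b1 * b2 * b3) = b1 * b2 - b3 - b1 ^+ 2 * b3.
Proof.
move=> e1 e2 e3.
transitivity (b1 * b2 - b3 - b1 ^+ 2 * b3 + (b3 + c1 + c3 * b1)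
  - b1 * (b2 + c3 + c2 * b3) + b1 * b3 * (b1 + c2 + c1 * b2)); first by ring.
by rewrite e1 e2 e3 !mulr0 subr0 !addr0.
Qed.
End Identities.

Definition phi : {rmorphism ratfun 4 -> M} := subst (mev0_injP theta_alg_indep).

Lemma phiX i : phi (Xf i) = theta X i.
Proof. exact: substX. Qed.

Lemma psi_phi g f : g \in SL2F3 -> psi g (phi f) = phi f.
Proof.
rewrite inE => /eqP dg; pose h : {rmorphism M -> M} := psi g \o phi.
apply: (ratfun_ext (f := h) (g := phi)) => i.
apply: etrans (congr1 (psi g) (phiX i)) _; apply: etrans _ (esym (phiX i)).
apply: etrans (fmorph_theta _ _ _) _.
by rewrite (eq_theta (l' := lin X (GLval g))) ?theta_lin // => j; apply: psi_X.
Qed.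

Lemma SL2F3_ex (A : 'M['F_3]_2) : \det A = 1 ->
  exists2 g : {'GL_2['F_3]}, g \in SL2F3 & GLval g = A.
Proof.
move=> dA; have uA : (A : 'M['F_3]_2.-1.+1) \is a GRing.unit.
  by rewrite unitmxE dA unitr1.
by exists (FinRing.Unit uA); rewrite // inE dA.
Qed.

(* Generators of SL2F3 acting as x1 -> x2 -> x3 -> x1, as left multiplication
   by i and - k, and as -1. *)
Lemma psi_gens :
  [/\ exists2 g, g \in SL2F3 &
         [/\ psi g x0 = x0, psi g x1 = x2, psi g x2 = x3 & psi g x3 = x1],
      exists2 g, g \in SL2F3 &
         [/\ psi g x0 = - x1, psi g x1 = x0, psi g x2 = - x3 & psi g x3 = x2],
      exists2 g, g \in SL2F3 &
         [/\ psi g x0 = x3, psi g x1 = x2, psi g x2 = - x1 & psi g x3 = - x0] &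
      exists2 g, g \in SL2F3 &
         [/\ psi g x0 = - x0, psi g x1 = - x1, psi g x2 = - x2 & psi g x3 = - x3]].
Proof.
have gE a b c d : a * d - b * c = 1 -> exists2 g, g \in SL2F3 &
   [/\ psi g x0 = vx2 X c d, psi g x1 = vx2 X a b,
       psi g x2 = vx2 X (a + c) (b + d) & psi g x3 = vx2 X (a - c) (b - d)].
  move=> e; have [|g gS gE] := SL2F3_ex (A := mx2 a b c d); first by rewrite det_mx2.
  exists g => //; have := lin_mx2 X a b c d; rewrite -gE => -[<- <- <- <-].
  by split; apply: psi_X.
split.
- by have [|g gS h] := gE 1 1 0 1; [exact: val_inj | exists g].
- by have [|g gS h] := gE 0 1 (-1) 0; [exact: val_inj | exists g].
- by have [|g gS h] := gE 1 1 1 (-1); [exact: val_inj | exists g].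
- by have [|g gS h] := gE (-1) 0 0 (-1); [exact: val_inj | exists g].
Qed.

Lemma fmorph_q11 (K L : fieldType) (f : {rmorphism K -> L}) a b c d :
  f (q11 a b c d) = q11 (f a) (f b) (f c) (f d).
Proof. by rewrite /q11 !rmorphB rmorphD !rmorphXn. Qed.

Lemma fmorph_bq (K L : fieldType) (f : {rmorphism K -> L}) a b c d :
  f (bq a b c d) = bq (f a) (f b) (f c) (f d).
Proof. by rewrite /bq fmorph_div fmorph_q11 /q12 rmorphMn rmorphB !rmorphM. Qed.

Lemma fmorph_rho (K L : fieldType) (f : {rmorphism K -> L}) a b c :
  f (rho a b c) = rho (f a) (f b) (f c).
Proof. by rewrite /rho fmorph_div !rmorphB. Qed.

Lemma bq_cong (K : fieldType) (x0 x1 x2 x3 y0 y1 y2 y3 e : K) : e != 0 ->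
  q12 y0 y1 y2 y3 = e * q12 x0 x1 x2 x3 -> q11 y0 y1 y2 y3 = e * q11 x0 x1 x2 x3 ->
  bq y0 y1 y2 y3 = bq x0 x1 x2 x3.
Proof. by move=> e0 h h'; rewrite /bq h h' -mulf_div divff // mul1r. Qed.

Lemma subfld_ratfun s (S : ratfun s -> Prop) : subfld S ->
  (forall i, S (Xf i)) -> forall m, S m.
Proof.
move=> hS SX m; have [n [d [_ ->]]] := fracP m.
have Sp p : S (FracField.tofrac p).
  elim/mpoly_rmorph_ind: p => [c|i|p q Sp Sq|p q Sp Sq]; last 2 first.
  - by rewrite tofracD; apply: subfldD.
  - by rewrite tofracM; apply: subfldM.
  - rewrite -mev_Xf (mevC (@pchar0_ratfun s)) /ratr.
    have Sz (z : int) : S z%:~R.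
      case: z => z; first exact: subfld_nat.
      by rewrite NegzE mulrNz; apply: subfldN => //; apply: subfld_nat.
    exact: subfld_div.
  exact: SX.
exact: subfld_div.
Qed.

Section FixedField.
Variables (K : fieldType) (x0 x1 x2 x3 : K).
Local Notation b1 := (bq x0 x1 x2 x3).
Local Notation b2 := (bq x0 x2 x3 x1).
Local Notation b3 := (bq x0 x3 x1 x2).
Local Notation c1 := (cq x0 x1 x2 x3).
Local Notation c2 := (cq x0 x2 x3 x1).
Local Notation c3 := (cq x0 x3 x1 x2).
Local Notation a := (fA b1 b2 b3).
Local Notation r := (rho b1 b2 b3).
Local Notation r1 := (q11 x0 x1 x2 x3).
Local Notation r2 := (q11 x0 x2 x3 x1).
Local Notation r3 := (q11 x0 x3 x1 x2).
Local Notation nrm := (qnorm x0 x1 x2 x3).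
Hypothesis nat_neq0 : forall n, n.+1%:R != 0 :> K.
Hypotheses (q1 : r1 != 0) (q2 : r2 != 0) (q3 : r3 != 0).
Hypotheses (d1 : b1 - b2 != 0) (d2 : b2 - b3 != 0) (d3 : b3 - b1 != 0).
Hypotheses (fD0 : fD b1 b2 b3 != 0) (bb0 : 1 + b1 * b2 * b3 != 0).
Hypotheses (norm0 : nrm != 0) (x0_neq0 : x0 != 0).
Hypothesis gen : forall S, subfld S -> S x0 -> S x1 -> S x2 -> S x3 -> forall m, S m.

Variables (s3 si sk sn : {rmorphism K -> K}).
Hypothesis h3 : [/\ s3 x0 = x0, s3 x1 = x2, s3 x2 = x3 & s3 x3 = x1].
Hypothesis hi : [/\ si x0 = - x1, si x1 = x0, si x2 = - x3 & si x3 = x2].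
Hypothesis hk : [/\ sk x0 = x3, sk x1 = x2, sk x2 = - x1 & sk x3 = - x0].
Hypothesis hn : [/\ sn x0 = - x0, sn x1 = - x1, sn x2 = - x2 & sn x3 = - x3].
Variable k : K -> Prop.
Hypothesis hS : subfld k.
Hypotheses (kE : k (fE b1 b2 b3)) (kA : k a) (kW : k (fW b1 b2 b3)) (kN : k nrm).
Hypothesis k_fixed : forall m, k m -> [/\ s3 m = m, si m = m, sk m = m & sn m = m].

Let m1 : -1 != 0 :> K. Proof. by rewrite oppr_eq0 oner_neq0. Qed.

Let s3b : [/\ s3 b1 = b2, s3 b2 = b3 & s3 b3 = b1].
Proof. by case: h3 => e0 e1 e2 e3; rewrite !fmorph_bq e0 e1 e2 e3. Qed.

Let sib : [/\ si b1 = b1, si b2 = b2 & si b3 = b3].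
Proof.
case: hi => e0 e1 e2 e3; rewrite !fmorph_bq e0 e1 e2 e3.
by split; [apply: (bq_cong (oner_neq0 _))|apply: (bq_cong m1)|apply: (bq_cong m1)];
  rewrite /q11 /q12; ring.
Qed.

Let skb : [/\ sk b1 = b1, sk b2 = b2 & sk b3 = b3].
Proof.
case: hk => e0 e1 e2 e3; rewrite !fmorph_bq e0 e1 e2 e3.
by split; [apply: (bq_cong m1)|apply: (bq_cong m1)|apply: (bq_cong (oner_neq0 _))];
  rewrite /q11 /q12; ring.
Qed.

Let snb : [/\ sn b1 = b1, sn b2 = b2 & sn b3 = b3].
Proof.
case: hn => e0 e1 e2 e3; rewrite !fmorph_bq e0 e1 e2 e3.
by split; apply: (bq_cong (oner_neq0 _)); rewrite /q11 /q12; ring.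
Qed.

Let s3k u : k u -> s3 u = u. Proof. by move=> /k_fixed []. Qed.
Let s3r : s3 r = r ^+ 2 - (a + 1) * r - 2.
Proof.
case: s3b => e1 e2 e3; rewrite -(rho_next d1 d2 d3) fmorph_rho e1 e2 e3; reflexivity.
Qed.
Let s3s3r : s3 (s3 r) = a - r - s3 r.
Proof.
case: s3b => e1 e2 e3; have e : s3 r = rho b2 b3 b1.
  by rewrite fmorph_rho e1 e2 e3.
by rewrite e fmorph_rho e1 e2 e3 rho_third.
Qed.

(** The bottom of the tower: k(r), with [s3] generating the cyclic action over [k]. *)
Let F1 := cext k r.
Let hF1 : subfld F1.
Proof.
exact: (subfld_cext hS s3k kA (rho_cubic d1 d2 d3) s3r s3s3r (nat_neq0 2)).
Qed.
Let F1_fixed m : F1 m -> s3 m = m -> k m.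
Proof.
exact: (cext_fixed hS s3k kA (rho_cubic d1 d2 d3) s3r s3s3r (nat_neq0 2)).
Qed.
Let kF1 u : k u -> F1 u. Proof. exact: cext_sub. Qed.

(** [diff_rho] gives b2 - b3, multiplying by r gives b1 - b2, and the sum [fE] then gives the b_i
    themselves. *)
Let F1_bq : [/\ F1 b1, F1 b2 & F1 b3].
Proof.
have Fr : F1 r by apply: cext_gen.
have Fd2 : F1 (b2 - b3).
  by rewrite (diff_rho d1 d2 d3 fD0); have := kF1 kW => ?; subfld hF1.
have Fd1 : F1 (b1 - b2) by rewrite -(divfK d2 (b1 - b2)); apply: (subfldM hF1).
have F2 : F1 b2.
  rewrite (_ : b2 = (fE b1 b2 b3 - (b1 - b2) + (b2 - b3)) / 3).
    by have := kF1 kE => ?; subfld hF1.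
  by rewrite /fE; field; apply: nat_neq0.
split=> //; first by rewrite -(subrK b2 b1); subfld hF1.
by rewrite -(subKr b2 b3); subfld hF1.
Qed.

Let F1_cq : [/\ F1 c1, F1 c2 & F1 c3].
Proof.
have [g1 g2 g3] := F1_bq.
have o1 := bq_orthogonal q1 q2; have o2 := bq_orthogonal q2 q3.
have o3 := bq_orthogonal q3 q1; have p0 := bb0.
have e1 := cq_bq o1 o2 o3; have e2 := cq_bq o2 o3 o1; have e3 := cq_bq o3 o1 o2.
have p2 : 1 + b2 * b3 * b1 = 1 + b1 * b2 * b3 by ring.
have p3 : 1 + b3 * b1 * b2 = 1 + b1 * b2 * b3 by ring.
rewrite p2 in e2; rewrite p3 in e3.
by split; [rewrite (canRL (mulfK p0) e1)|rewrite (canRL (mulfK p0) e2)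
  |rewrite (canRL (mulfK p0) e3)]; subfld hF1.
Qed.

Let F1_sq y1 y2 y3 : qnorm x0 y1 y2 y3 = nrm -> q11 x0 y1 y2 y3 != 0 ->
  F1 (bq x0 y1 y2 y3) -> F1 (cq x0 y1 y2 y3) -> F1 (q11 x0 y1 y2 y3 ^+ 2).
Proof.
move=> e q Fb Fc; have := q11_sq q; rewrite e; set w := 1 + _ + _ => h.
have w0 : w != 0.
  apply: contraNneq norm0 => w0; move: h; rewrite w0 mulr0 => /esym/eqP.
  by rewrite sqrf_eq0.
by rewrite (canRL (mulfK w0) h) /w; have := kF1 kN => ?; subfld hF1.
Qed.

Let F1_ik u : F1 u -> [/\ si u = u, sk u = u & sn u = u].
Proof.
case=> [v [w [t [/k_fixed [_ iv kv nv] /k_fixed [_ iw kw nw] /k_fixed [_ it kt nt] ->]]]].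
case: sib skb snb => e1 e2 e3 [g1 g2 g3] [l1 l2 l3].
have [ir kr nr] : [/\ si r = r, sk r = r & sn r = r].
  by rewrite !fmorph_rho e1 e2 e3 g1 g2 g3 l1 l2 l3.
have sE (s : {rmorphism K -> K}) x : s x = x -> s v = v -> s w = w -> s t = t ->
    s (v + w * x + t * x ^+ 2) = v + w * x + t * x ^+ 2.
  by move=> ex ev ew et; rewrite !rmorphD !rmorphM /= ex ev ew et.
by split; apply: sE.
Qed.

(** Over [F1], fixed by [sk], the entry r11 has its square in [F1] and is negated by [sk]. *)
Let F2 := qext F1 r1.
Let skr1 : sk r1 = - r1.
Proof. by case: hk => e0 e1 e2 e3; rewrite fmorph_q11 e0 e1 e2 e3 /q11; ring. Qed.
Let hF2 : subfld F2.
Proof.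
case: F1_bq F1_cq => g1 g2 g3 [l1 l2 l3].
exact: (subfld_qext hF1 (fun u h => let: And3 _ e _ := F1_ik h in e)
  (F1_sq erefl q1 g1 l1) skr1).
Qed.
Let F2_fixed m : F2 m -> sk m = m -> F1 m.
Proof.
exact: (qext_fixed (fun u h => let: And3 _ e _ := F1_ik h in e) skr1 (nat_neq0 1) q1).
Qed.
Let F12 u : F1 u -> F2 u. Proof. exact: qext_sub. Qed.

Let F2_in u : F2 u -> si u = u /\ sn u = u.
Proof.
case=> v [w [/F1_ik [iv _ nv] /F1_ik [iw _ nw] ->]].
rewrite !rmorphD !rmorphM /= iv nv iw nw; case: hi hn => e0 e1 e2 e3 [g0 g1 g2 g3].
by rewrite !fmorph_q11 e0 e1 e2 e3 g0 g1 g2 g3 /q11; split; ring.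
Qed.

(** Here [si] plays the same part: it fixes r11, hence [F2], and negates r22. *)
Let F3 := qext F2 r2.
Let sir2 : si r2 = - r2.
Proof. by case: hi => e0 e1 e2 e3; rewrite fmorph_q11 e0 e1 e2 e3 /q11; ring. Qed.
Let hF3 : subfld F3.
Proof.
case: F1_bq F1_cq => g1 g2 g3 [l1 l2 l3].
exact: (subfld_qext hF2 (fun u h => (F2_in h).1)
  (F12 (F1_sq (qnorm_cyc _ _ _ _) q2 g2 l2)) sir2).
Qed.
Let F3_fixed m : F3 m -> si m = m -> F2 m.
Proof.
exact: (qext_fixed (fun u h => (F2_in h).1) sir2 (nat_neq0 1) q2).
Qed.
Let F13 u : F1 u -> F3 u. Proof. by move/F12; apply: qext_sub. Qed.

Let F3_n u : F3 u -> sn u = u.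
Proof.
case=> v [w [/F2_in [_ nv] /F2_in [_ nw] ->]].
rewrite rmorphD rmorphM /= nv nw; case: hn => g0 g1 g2 g3.
by rewrite fmorph_q11 g0 g1 g2 g3 /q11; ring.
Qed.

Let F3_q11 : [/\ F3 r1, F3 r2 & F3 r3].
Proof.
have F3r1 : F3 r1 by apply: (qext_sub hF2); apply: (qext_gen hF1).
have F3r2 : F3 r2 by apply: (qext_gen hF2).
split=> //; rewrite -(canLR (mulfK norm0) (q11_det q1 q2)).
case: F1_bq F1_cq => /F13 g1 _ _ [_ /F13 g2 _]; have := F13 (kF1 kN) => ?.
by subfld hF3.
Qed.

Let F4 := qext F3 x0.
Let F34 u : F3 u -> F4 u. Proof. exact: qext_sub. Qed.
(** A quaternion is recovered from its matrix: N plus the trace is 4 x0^2, and the antisymmetric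
    part, r32 - r23 and its cyclic images, gives 4 x0 x1, 4 x0 x2 and 4 x0 x3. *)
Let F3_x0 : [/\ F3 (x0 ^+ 2), F3 (x0 * x1), F3 (x0 * x2) & F3 (x0 * x3)].
Proof.
case: F3_q11 => f1 f2 f3; have fN := F13 (kF1 kN).
case: F1_bq => /F13 g1 /F13 g2 /F13 g3; case: F1_cq => /F13 l1 /F13 l2 /F13 l3.
have fb x y z : q11 x0 x y z != 0 -> q12 x0 x y z = bq x0 x y z * q11 x0 x y z.
  by move=> q; rewrite divfK.
have fc x y z : q11 x0 x y z != 0 -> q13 x0 x y z = cq x0 x y z * q11 x0 x y z.
  by move=> q; rewrite divfK.
have n4 := nat_neq0 3; split.
- rewrite (_ : _ ^+ 2 = (nrm + r1 + r2 + r3) / 4); first by subfld hF3.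
  by rewrite /qnorm /q11; field.
- rewrite (_ : _ * _ = (c3 * r3 - b2 * r2) / 4); first by subfld hF3.
  by rewrite -fb // -fc // /q12 /q13; field.
- rewrite (_ : _ * _ = (c1 * r1 - b3 * r3) / 4); first by subfld hF3.
  by rewrite -fb // -fc // /q12 /q13; field.
- rewrite (_ : _ * _ = (c2 * r2 - b1 * r1) / 4); first by subfld hF3.
  by rewrite -fb // -fc // /q12 /q13; field.
Qed.

Let hF4 : subfld F4.
Proof.
case: F3_x0 hn => e _ _ _ [e0 _ _ _].
exact: (subfld_qext hF3 F3_n e e0).
Qed.

Let F4_all m : F4 m.
Proof.
have F4x0 : F4 x0 by apply: (qext_gen hF3).
have F4x x : F3 (x0 * x) -> F4 x.
  by move=> /F34 h; rewrite -(mulKf x0_neq0 x); subfld hF4.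
by case: F3_x0 => _ /F4x f1 /F4x f2 /F4x f3; apply: gen.
Qed.

(** [F4] is all of [K]; invariance under [sn], [si], [sk] and [s3], in this order, brings [m] down
    the tower to [k]. *)
Lemma fixed_subfield m : s3 m = m -> si m = m -> sk m = m -> sn m = m -> k m.
Proof.
move=> e3 ei ek en; apply: F1_fixed => //; apply: F2_fixed => //.
apply: F3_fixed => //; case: hn => e0 _ _ _.
exact: (qext_fixed F3_n e0 (nat_neq0 1) x0_neq0 (F4_all m) en).
Qed.
End FixedField.

Lemma psi_fixed m : (forall g, g \in SL2F3 -> psi g m = m) -> exists f, m = phi f.
Proof.
move=> hm; have [[g3 G3 h3] [gi Gi hi] [gk Gk hk] [gn Gn hn]] := psi_gens.
have [q1 q2 q3] := q11_neq0; have [d1 d2 d3] := bq_distinct.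
have nat0 n : n.+1%:R != 0 :> M by rewrite ((pcharf0P _).1 cM).
have [hx0 _ _ _] := spec_pt.
have x00 : x0 != 0 by apply: (spec_coef_neq0 pchar0_rat hx0).
pose k m := exists f, m = phi f.
have hS : subfld k.
  split; first by exists 1; rewrite rmorph1.
  + by move=> _ _ [u ->] [v ->]; exists (u - v); rewrite rmorphB.
  + by move=> _ _ [u ->] [v ->]; exists (u * v); rewrite rmorphM.
  + by move=> _ [u ->]; exists u^-1; rewrite fmorphV.
have kT i : k (theta X i) by exists (Xf i); rewrite phiX.
have gen S : subfld S -> S x0 -> S x1 -> S x2 -> S x3 -> forall m, S m.
  move=> hS' f0 f1 f2 f3; apply: (subfld_ratfun hS') => i.
  by rewrite -(inord_val i); case: i => [[|[|[|[|i]]]]].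
have kfix u : k u -> [/\ psi g3 u = u, psi gi u = u, psi gk u = u & psi gn u = u].
  by case=> f ->; split; apply: psi_phi.
exact: (fixed_subfield nat0 q1 q2 q3 d1 d2 d3 fD_neq0 bq_prod_neq0 qnorm_neq0 x00 gen
  h3 hi hk hn hS (kT (@Ordinal 4 0 isT)) (kT (@Ordinal 4 1 isT))
  (kT (@Ordinal 4 2 isT)) (kT (@Ordinal 4 3 isT)) kfix
  (hm _ G3) (hm _ Gi) (hm _ Gk) (hm _ Gn)).
Qed.

(** * Specialisation to Galois extensions *)

Section SpecPoly.
Variables (K : fieldType) (charK : [pchar K] =i pred0) (s : nat) (x : 'I_s -> K).

Lemma spec_poly_mul P P' Q Q' : spec_poly x P Q -> spec_poly x P' Q' ->
  spec_poly x (P * P') (Q * Q').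
Proof.
move=> h h' i; rewrite !coefM.
elim/big_rec2: _ => [|j m k _ hm]; first exact: spec_coef0.
by apply: (spec_coefD charK) => //; apply: (spec_coefM charK).
Qed.

Lemma spec_poly_XsubC m k : spec_coef x m k -> spec_poly x ('X - m%:P) ('X - k%:P).
Proof.
move=> h i; rewrite !coefB !coefX !coefC; apply: (spec_coefB charK).
  exact: spec_coef_nat.
by case: eqP => // _; apply: spec_coef0.
Qed.

Lemma spec_poly_prod_XsubC (I : eqType) (r : seq I) (f : I -> ratfun s) (g : I -> K) :
  {in r, forall i, spec_coef x (f i) (g i)} ->
  spec_poly x (\prod_(i <- r) ('X - (f i)%:P)) (\prod_(i <- r) ('X - (g i)%:P)).
Proof.
elim: r => [|i r IH] h.
  rewrite !big_nil => j; rewrite !coefC; case: eqP => _.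
    exact: spec_coef1.
  exact: spec_coef0.
rewrite !big_cons; apply: spec_poly_mul.
  by apply: spec_poly_XsubC; apply: h; rewrite mem_head.
by apply: IH => j jr; apply: h; rewrite inE jr orbT.
Qed.
End SpecPoly.

Lemma fmorph_spec_coef s (K L : fieldType) (f : {rmorphism K -> L}) (x : 'I_s -> K) m k :
  spec_coef x m k -> spec_coef (f \o x) m (f k).
Proof.
case=> n [d [d0 -> ->]]; exists n, d.
by rewrite -!fmorph_mev fmorph_eq0 fmorph_div.
Qed.

Lemma vx_lincomb (R : pzRingType) (T : finType) (P : pred T) (c : T -> R)
    (l : T -> 'I_4 -> R) v :
  vx (fun j => \sum_(p | P p) c p * l p j) v = \sum_(p | P p) c p * vx (l p) v.
Proof.
rewrite /vx /vx2; do ! case: ifP => _ //.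
all: try by rewrite -sumrN; apply: eq_bigr => p _; rewrite mulrN.
by rewrite big1 // => p _; rewrite mulr0.
Qed.

(** In the coordinates given by the coefficients of the combination, [h] becomes a nonzero
    polynomial over [L], since the family spans. Natural coefficients are sought because
    automorphisms fix them. *)
Lemma mev_lincomb_neq0 s (L : fieldType) (charL : [pchar L] =i pred0) (T : finType)
    (G : T -> 'I_s -> L) (h : {mpoly rat[s]}) :
  (forall t : 'I_s -> L, exists c : T -> L, forall j, \sum_p c p * G p j = t j) ->
  h != 0 -> exists k : T -> nat, mev (fun j => \sum_p (k p)%:R * G p j) h != 0.
Proof.
move=> surj h0.
pose f : rat -> {mpoly L[#|T|]} := @mpolyC #|T| L \o ratr0 charL.
pose Y j : {mpoly L[#|T|]} := \sum_p (G p j)%:MP * 'X_(enum_rank p).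
pose g := mmap f Y h.
have gE (v : 'I_#|T| -> L) : g.@[v] = mev (fun j => \sum_p v (enum_rank p) * G p j) h.
  rewrite /g; elim/mpoly_rmorph_ind: h {h0 g} => [c|i|p q Hp Hq|p q Hp Hq].
  - by rewrite mevC // (mmapC Y f) /= mevalC.
  - rewrite mevX // (mmapX Y f) mmap1U /Y raddf_sum /=; apply: eq_bigr => p _.
    by rewrite mevalM mevalC mevalXU mulrC.
  - by rewrite mevD // (mmapD Y f) mevalD Hp Hq.
  - by rewrite mevM // (rmorphM (mmap f Y)) mevalM Hp Hq.
(* By spanning, [g] takes at some point the value of [h] at a point where [h] is nonzero. *)
have g0 : g != 0.
  have [k kP] := mev_generic h0; have := kP L charL.
  have [c cE] := surj (fun i => (k i)%:R).
  apply: contraNneq => g0; have := gE (fun i => c (enum_val i)).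
  rewrite g0 meval0 => e; apply/eqP; rewrite [RHS]e; apply: eq_mev => j.
  by rewrite -cE; apply: eq_bigr => p _; rewrite enum_rankK.
have [k kP] := mpoly_nat_neq0 charL g0.
by exists (fun p => k (enum_rank p)); rewrite -(gE (fun i => (k i)%:R)).
Qed.

Section Galois.
Variables (K : fieldType) (charK : [pchar K] =i pred0) (L : splittingFieldType K).
Hypothesis galL : galois 1%VS (fullv : {vspace L}).
Local Notation E := (fullv : {vspace L}).
Local Notation Gal := ('Gal(E / 1%VS))%g.
Variable chi : gal_of E -> {'GL_2['F_3]}.
Hypothesis chiM : {in Gal &, {morph chi : s t / (s * t)%g}}.
Hypothesis chi_inj : {in Gal &, injective chi}.
Hypothesis chi_SL : {in Gal, forall s, chi s \in SL2F3}.

Let charL : [pchar L] =i pred0.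
Proof. by move=> p; rewrite (fmorph_pchar (in_alg L)) charK. Qed.

(* Averaging over the Galois group the twisted action that fixes precisely
   the points x with s x = x (chi s). *)
Definition twist (l : 'I_4 -> L) (j : 'I_4) : L :=
  \sum_(s in Gal) vx (fun i => s (l i)) (rep j *m GLval (chi s)^-1).

(** Applying [t] reindexes the sum by s |-> s * t; the change in the matrix factor is [chi t]. *)
Lemma twist_gal l t j : t \in Gal -> t (twist l j) = lin (twist l) (GLval (chi t)) j.
Proof.
move=> tG; rewrite /lin.
have -> : vx (twist l) (rep j *m GLval (chi t)) =
    \sum_(s in Gal) vx (fun i => s (l i)) (rep j *m GLval (chi t) *m GLval (chi s)^-1).
  rewrite /twist (eq_vx (l' := fun j => \sum_(s in Gal)
     1 * vx (fun i => s (l i)) (rep j *m GLval (chi s)^-1))); last first.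
    by move=> i; apply: eq_bigr => s _; rewrite mul1r.
  by rewrite vx_lincomb; apply: eq_bigr => s _; rewrite mul1r vx_mulmx.
rewrite /twist raddf_sum [RHS](reindex_inj (mulIg t)) /=.
apply: eq_big => [s|s sG]; first by rewrite groupMr.
rewrite raddf_vx chiM //; have -> : rep j *m GLval (chi s)^-1 =
    rep j *m GLval (chi t) *m GLval (chi s * chi t)^-1.
  rewrite -mulmxA; congr (_ *m _); rewrite -[RHS]/(GLval (chi t * (chi s * chi t)^-1)).
  by rewrite invMg mulKVg.
by apply: eq_vx => i /=; rewrite galM ?memvf.
Qed.

Let n := #|Gal|.

(** For a suitable tuple [w] the matrix of its conjugates is invertible, so [L]-linear combinations
    can isolate the term s = 1 of the twisted sums. *)
Lemma twist_span : exists l : 'I_n * 'I_4 -> 'I_4 -> L,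
  forall t : 'I_4 -> L, exists c, forall j, \sum_p c p * twist (l p) j = t j.
Proof.
have [w _ [uA _ _]] := gal_matrix Gal; set A := (X in X \in _) in uA.
pose l (p : 'I_n * 'I_4) (i : 'I_4) : L := if i == p.2 then tnth w p.1 else 0.
exists l => t; have G1 : 1%g \in Gal by apply: group1.
pose i1 : 'I_n := enum_rank_in G1 1%g.
(* The column of the inverse matrix at the identity kills every term with s != 1. *)
exists (fun p => t p.2 * (invmx A) p.1 i1) => j.
have key s i : s \in Gal ->
    \sum_p (t p.2 * (invmx A) p.1 i1) * s (l p i) = if s == 1%g then t i else 0.
  move=> sG; rewrite -(pair_bigA _ (fun m i' => t i' * invmx A m i1 * s (l (m, i') i))) /=.
  transitivity (t i * \sum_m A (enum_rank_in G1 s) m * invmx A m i1).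
    rewrite mulr_sumr; apply: eq_bigr => m _; rewrite (bigD1 i) //= big1 => [|i' ii'].
      by rewrite addr0 /l /= eqxx mxE enum_rankK_in // mulrAC mulrA mulrAC.
    by rewrite /l /= eq_sym (negbTE ii') rmorph0 mulr0.
  have := congr1 (fun B : 'M_n => B (enum_rank_in G1 s) i1) (mulmxV uA).
  rewrite !mxE => ->; rewrite (can_in_eq (enum_rankK_in G1)) //.
  by case: eqP => _; rewrite ?mulr1 ?mulr0.
rewrite (eq_bigr (fun p => \sum_(s in Gal) t p.2 * (invmx A) p.1 i1 *
   vx (fun i => s (l p i)) (rep j *m GLval (chi s)^-1))); last first.
  by move=> p _; rewrite mulr_sumr.
rewrite exchange_big (bigD1 1%g) //= [X in _ + X]big1 ?addr0 => [|s /andP [sG s1]].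
  rewrite -vx_lincomb (eq_vx (l' := t)); last by move=> i; rewrite key // eqxx.
  have -> : chi 1%g = 1%g.
    by apply: (mulIg (chi 1%g)); rewrite -chiM // !mul1g.
  rewrite -[RHS](vx_rep t); congr vx.
  by apply: etrans (mulmx1 _); congr (_ *m _); apply: invr1.
rewrite -vx_lincomb (eq_vx (l' := fun=> 0)); last by move=> i; rewrite key // (negbTE s1).
by rewrite /vx /vx2 oppr0; do ! case: ifP.
Qed.

Lemma equivariant_point (h : {mpoly rat[4]}) : h != 0 ->
  exists2 x : 'I_4 -> L, mev x h != 0 &
    {in Gal, forall (t : gal_of E) j, t (x j) = lin x (GLval (chi t)) j}.
Proof.
move=> h0; have [l lP] := twist_span.
have [k kh] := mev_lincomb_neq0 charL lP h0.
exists (fun j => \sum_p (k p)%:R * twist (l p) j) => // t tG j.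
rewrite /lin vx_lincomb rmorph_sum; apply: eq_bigr => p _.
by rewrite rmorphM rmorph_nat /= twist_gal.
Qed.

End Galois.

Section SplittingSpecialisation.
Variables (K : fieldType) (charK : [pchar K] =i pred0) (L : splittingFieldType K).
Hypothesis galL : galois 1%VS (fullv : {vspace L}).
Local Notation E := (fullv : {vspace L}).
Local Notation Gal := ('Gal(E / 1%VS))%g.
Variable chi : gal_of E -> {'GL_2['F_3]}.
Hypothesis chiM : {in Gal &, {morph chi : s t / (s * t)%g}}.
Hypothesis chi_inj : {in Gal &, injective chi}.
Hypothesis chi_SL : {in Gal, forall s, chi s \in SL2F3}.
Variable P : {poly ratfun 4}.
Hypothesis PE : map_poly phi P = \prod_(x <- conjugates SL2F3_group psi zM) ('X - x%:P).

Let charL : [pchar L] =i pred0.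
Proof. by move=> p; rewrite (fmorph_pchar (in_alg L)) charK. Qed.

Lemma phi_tofrac p : phi (FracField.tofrac p) = mev (theta X) p.
Proof. exact: frac_lift_tofrac. Qed.

Lemma spec_coef_phi (x tau : 'I_4 -> L) f k :
  (forall i, spec_coef x (theta X i) (tau i)) -> spec_coef tau f k ->
  spec_coef x (phi f) k.
Proof. exact: (@spec_coef_subst 4 4 (theta X)). Qed.

Lemma gal_fixed (m : L) : {in Gal, forall s : gal_of E, s m = m} -> exists k : K, m = k%:A.
Proof.
move=> h; have : m \in fixedField Gal by apply/fixedFieldP; rewrite ?memvf.
by rewrite (galois_fixedField _) // => /vlineP.
Qed.

Lemma splitting_specialisation : exists (tau : 'I_4 -> K) (Q : {poly K}),
  spec_poly tau P Q /\ splittingFieldFor 1%VS (map_poly (in_alg L) Q) E.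
Proof.
have [nd ndP] : exists nd : nat -> {mpoly rat[4]} * {mpoly rat[4]},
    forall i, (nd i).2 != 0 /\ P`_i = FracField.tofrac (nd i).1 / FracField.tofrac (nd i).2.
  exists (fun i => (\n_(repr P`_i), \d_(repr P`_i))) => i /=.
  by split; [exact: denom_ratioP | exact: frac_numden].
(* At [x], the invariants must be defined, the denominators of the coefficients of [P] must survive,
   and a conjugate of [zM] different from [zM] must keep a different value. *)
pose bad : seq M := [seq theta X i | i <- enum 'I_4]
  ++ [seq phi (FracField.tofrac (nd i).2) | i <- iota 0 (size P)]
  ++ [seq psi g zM - zM | g <- enum SL2F3].
have [h h0 hP] := spec_coef_generic_seq bad.
have [x hx xG] := equivariant_point charK chiM h0.
have {hP} hx m : m \in bad -> exists2 k, spec_coef x m k & (m != 0 -> k != 0).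
  exact: (hP L charL x hx).
have /fin_all_exists [tau tauP] (i : 'I_4) : exists k, spec_coef x (theta X i) k.
  have [|k kP _] := hx (theta X i); last by exists k.
  by rewrite mem_cat map_f ?mem_enum.
(* [s] sends the value of an invariant at [x] to its value at [lin x (chi s)], which is the same
   because [psi (chi s)] fixes the invariant. *)
have /fin_all_exists [tau0 tau0E] (i : 'I_4) : exists k : K, tau i = k%:A.
  apply: gal_fixed => s sG.
  have e : s \o x =1 lin x (GLval (chi s)) by move=> j; apply: xG.
  have /(eq_spec_coef e) h1 := fmorph_spec_coef s (tauP i).
  have h2 := spec_coef_psi charL h1; apply: (spec_coef_inj charL h2).
  by rewrite -phiX psi_phi ?chi_SL // phiX.
have tauE : tau =1 in_alg L \o tau0 by move=> i; rewrite tau0E.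
pose n i := (nd i).1; pose d i := (nd i).2.
have mtau p : mev tau p = in_alg L (mev tau0 p) by rewrite fmorph_mev; apply: eq_mev.
have dtau i : (i < size P)%N -> mev tau0 (d i) != 0.
  move=> iP; have [d0 _] := ndP i.
  have [|k kP] := hx (phi (FracField.tofrac (d i))).
    rewrite !mem_cat; apply/orP; right; apply/orP; left; apply: map_f.
    by rewrite mem_iota.
  rewrite fmorph_eq0 tofrac_eq0 d0 => /(_ isT) k0.
  move: kP; rewrite phi_tofrac => kP.
  have := spec_coef_mev charL (d i) tauP => /(spec_coef_inj charL kP) kE.
  by move: k0; rewrite kE mtau fmorph_eq0.
pose Q := \poly_(i < size P) (mev tau0 (n i) / mev tau0 (d i)).
have PQ : spec_poly tau0 P Q.
  move=> i; rewrite coef_poly; case: ltnP => iP.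
    by have [_ ->] := ndP i; exists (n i), (d i); split=> //; apply: dtau.
  by rewrite nth_default //; apply: spec_coef0.
pose zx (g : {'GL_2['F_3]}) : L :=
  lin x (GLval g) (inord 2) + lin x (GLval g) (inord 3).
have zxP g : spec_coef x (psi g zM) (zx g).
  apply: spec_coef_psi => //; apply: (spec_coefD charL); exact: (spec_coefX charL).
pose rs := [seq zx g | g <- enum SL2F3].
have QE : map_poly (in_alg L) Q = \prod_(z <- rs) ('X - z%:P).
  (* Both coefficients are specialisations at [x] of the same element [phi P_i]. *)
  apply/polyP => i; apply: (@spec_coef_inj _ charL _ x (phi P`_i)).
    rewrite coef_map; apply: (spec_coef_phi tauP).
    have e : in_alg L \o tau0 =1 tau by move=> j; rewrite tauE.
    exact: (eq_spec_coef e (fmorph_spec_coef (in_alg L) (PQ i))).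
  rewrite -coef_map PE /conjugates /rs !big_map.
  by apply: (spec_poly_prod_XsubC charL) => g _; apply: zxP.
exists tau0, Q; split=> //; exists rs; first by rewrite QE eqpxx.
pose E1 : {subfield L} := <<1 & rs>>%AS.
have galE1 : galois E1 E by apply: galoisS galL; rewrite sub1v subvf.
apply/eqP; rewrite eqEsubv subvf /= -[X in (_ <= X)%VS]/(E1 : {vspace L}).
rewrite -(galois_fixedField galE1).
apply/subvP => y _; apply/fixedFieldP; first exact: memvf.
(* An automorphism fixing the roots fixes the value of [zM] at [x], so [psi (chi s) zM] and [zM]
   have the same value there; by the choice of [bad] they coincide, and the stabiliser is
   trivial. *)
move=> s sG1; suff -> : s = 1%g by rewrite gal_id.
have sG : s \in Gal by apply: (subsetP (galS _ (sub1v E1))).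
have zx1 : zx 1%g = x (inord 2) + x (inord 3) by rewrite /zx !lin1.
have szx : s (zx 1%g) = zx (chi s) by rewrite zx1 rmorphD /= !xG.
have : s (zx 1%g) = zx 1%g.
  apply: (fixed_gal (subvf E1) sG1); apply: seqv_sub_adjoin.
  by apply: map_f; rewrite mem_enum (group1 SL2F3_group).
rewrite szx => zE; have chi1 : chi 1%g = 1%g.
  by apply: (mulIg (chi 1%g)); rewrite -chiM ?group1 // !mul1g.
apply: chi_inj => //; rewrite ?group1 // chi1; apply: psi_zM; first exact: chi_SL.
apply/eqP; rewrite -subr_eq0; apply: contraT => nz.
have [|k kP] := hx (psi (chi s) zM - zM).
  rewrite !mem_cat; apply/orP; right; apply/orP; right.
  by apply: (map_f (fun g => psi g zM - zM)); rewrite mem_enum chi_SL.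
move=> /(_ nz); have z0 : spec_coef x zM (zx 1%g).
  by rewrite zx1; apply: (spec_coefD charL); apply: (spec_coefX charL).
have := spec_coefB charL (zxP (chi s)) z0.
by move=> /(spec_coef_inj charL kP) ->; rewrite zE subrr eqxx.
Qed.
End SplittingSpecialisation.

Lemma psi_zM_inj : {in SL2F3_group &, injective (fun g => psi g zM)}.
Proof.
move=> g h gG hG gh; have e : psi g zM = psi h zM := gh.
apply/eqP; rewrite eq_mulgV1; apply/eqP; apply: psi_zM.
  by rewrite (groupM (G := SL2F3_group)) ?(groupV SL2F3_group).
apply: etrans (psiM _ _ _) _; apply: etrans (congr1 (psi h^-1%g) e) _.
rewrite -psiM mulgV; apply: (fmorph_inj (psi 1%g)).
by rewrite -psiM mulg1.
Qed.

Theorem theorem1 :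
  exists (s : nat) (P : {poly ratfun s}), generic_poly SL2F3 P.
Proof.
have hM : {in SL2F3_group &, forall g h m, psi (g * h)%g m = psi h (psi g m)}.
  by move=> g h _ _ m; apply: psiM.
have hphi : {in SL2F3_group, forall g f, psi g (phi f) = phi f}.
  by move=> g gG f; apply: psi_phi.
have [P PE] := prod_conjugatesE hM psi_fixed psi_zM_inj.
exists 4, P; split; first exact: (artin_splitting hM hphi psi_fixed psi_zM_inj PE).
move=> K charK L galL [H [HG /isogP [f injf fH]]].
apply: (splitting_specialisation charK galL (chi := f)) PE.
- exact: morphM.
- exact/injmP.
- by move=> s sG; apply: (subsetP HG); rewrite -fH mem_morphim.
Qed.
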